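(* Consider an instance generated by an IMLSBM in $\mathcal P_n(\rho,\{p_\ell\},\{q_\ell\},\beta)$ with $\rho\in(0,1/2)$, $\rho=o(1)$, $p_\ell\asymp q_\ell=o(1)$ for all $\ell$, $\beta=1+o(1)$ and $L\le n^c$ for a constant $c>0$. Suppose the procedure Init satisfies the consistent-initialization assumption, and that for some constant $c'\in(0,1)$, $$\log L+Le^{-c'J_\rho}=o\Big(\min_{S\subseteq[L]}\mathcal I_S\Big)\quad\text{and}\quad\min_{S\subseteq[L]}\mathcal I_S\to\infty.$$ Then there is a sequence $\bar\delta_n=o(1)$ such that the global estimator $\hat{\mathbf z}^\star$ output by Algorithm 3 satisfies $$\lim_{n\to\infty}\inf_{\mathbf z^\star\in\mathcal P_n}\mathbb P\Big(\mathcal L(\hat{\mathbf z}^\star,\mathbf z^\star)\le\exp\Big\{-(1-\bar\delta_n)\min_{S\subseteq[L]}\mathcal I_S\Big\}\Big)=1.$$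
   Context: Inhomogeneous multilayer SBM (IMLSBM). Fix integers $n,L\ge1$, a global label vector $\mathbf z^\star\in\{\pm1\}^n$, $\rho\in[0,1/2]$, and $0<q_\ell<p_\ell<1$ for $\ell\in[L]$. Individual label vectors $\mathbf z^{(\ell)}_i=\mathbf z^\star_i\xi_{\ell i}$ with $\xi_{\ell i}$ i.i.d., $P(\xi_{\ell i}=1)=1-\rho$, $P(\xi_{\ell i}=-1)=\rho$. Given the labels, the symmetric adjacency matrices $A^{(\ell)}\in\{0,1\}^{n\times n}$ have zero diagonal and independent entries $A^{(\ell)}_{ij}=A^{(\ell)}_{ji}$ ($i<j$), Bern$(p_\ell)$ if $\mathbf z^{(\ell)}_i=\mathbf z^{(\ell)}_j$ and Bern$(q_\ell)$ otherwise. $\mathcal P_n(\rho,\{p_\ell\},\{q_\ell\},\beta)$: such models with $n/(2\beta)\le\#\{i:\mathbf z^\star_i=\pm1\}\le n\beta/2$; an infimum ''over $\mathbf z^\star\in\mathcal P_n$'' ranges over all such $\mathbf z^\star$. Loss $\mathcal L(\hat{\mathbf z},\mathbf z)=n^{-1}\min\{d_H(\hat{\mathbf z},\mathbf z),d_H(-\hat{\mathbf z},\mathbf z)\}$. Probabilities are over labels and edges; asymptotics as $n\to\infty$; ''$p_\ell\asymp q_\ell=o(1)$'' means $q_\ell<p_\ell\le Cq_\ell$ for a constant $C$ independent of $n,\ell$ and $\max_\ell p_\ell\to0$. Information quantities: $I^{(\ell)}_t=-\log\big\{[p_\ell^{1-t}q_\ell^t+(1-p_\ell)^{1-t}(1-q_\ell)^t][p_\ell^tq_\ell^{1-t}+(1-p_\ell)^t(1-q_\ell)^{1-t}]\big\}$;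 $\psi_S(t)=-\frac n2\sum_{\ell\in S}I^{(\ell)}_t$; $\psi_S^\star(a)=\sup_{0\le t\le1}\{at-\psi_S(t)\}$; $J_\rho=-\log(2\sqrt{\rho(1-\rho)})$; $\mathcal I_S=|S^c|J_\rho+\psi^\star_S(0)$ if $|S^c|$ is even and $(|S^c|+1)J_\rho+\psi_S^\star(-2J_\rho)$ if $|S^c|$ is odd, $S^c=[L]\setminus S$. Algorithm 3 (inputs $\{A^{(\ell)}\}$, $\{p_\ell,q_\ell\}$, $\rho$, and a procedure Init). For $i\in[n]$, $\ell\in[L]$, $s_\star,s_\ell\in\{\pm1\}$ and a vector $\tilde{\mathbf z}$ indexed by $[n]\setminus\{i\}$, set $f^{(\ell)}_i(s_\star,s_\ell,\tilde{\mathbf z})=\log\frac{1-\rho}{\rho}\mathbf 1\{s_\ell=s_\star\}+\sum_{j\ne i:\tilde{\mathbf z}_j=s_\ell}\big[\log\frac{p_\ell(1-q_\ell)}{q_\ell(1-p_\ell)}A^{(\ell)}_{ij}+\log\frac{1-p_\ell}{1-q_\ell}\big]$. Stage I: for each $i$, run Init on the multilayer network $\{A^{(\ell)}_{-i,-i}\}$ obtained by deleting node $i$, obtaining $\tilde{\mathbf z}^{(-i)}\in\{\pm1\}^{[n]\setminus\{i\}}$. Stage II: for each $i$, compute $(\bar s^{\star}_i,\bar s^{1}_i,\dots,\bar s^{L}_i)\in\arg\max_{s_\star,s_1,\dots,s_L\in\{\pm1\}}\sum_\ell f^{(\ell)}_i(s_\star,s_\ell,\tilde{\mathbf z}^{(-i)})$;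 define $\bar{\mathbf z}^{\star,-i}\in\{\pm1\}^n$ by $\bar{\mathbf z}^{\star,-i}_j=\tilde{\mathbf z}^{(-i)}_j$ for $j\ne i$ and $\bar{\mathbf z}^{\star,-i}_i=\bar s^\star_i$, and $\bar{\mathbf z}^{\ell,-i}$ likewise with $\bar{\mathbf z}^{\ell,-i}_i=\bar s^\ell_i$. Stage III (alignment): $\hat{\mathbf z}^\star_1=\bar{\mathbf z}^{\star,-1}_1$, $\hat{\mathbf z}^{(\ell)}_1=\bar{\mathbf z}^{\ell,-1}_1$; for $i\ge2$, $\hat{\mathbf z}^\star_i\in\arg\max_{s\in\{\pm1\}}\#\big(\{j:\bar{\mathbf z}^{\star,-1}_j=s\}\cap\{j:\bar{\mathbf z}^{\star,-i}_j=\bar{\mathbf z}^{\star,-i}_i\}\big)$ and $\hat{\mathbf z}^{(\ell)}_i\in\arg\max_{s\in\{\pm1\}}\#\big(\{j:\bar{\mathbf z}^{\ell,-1}_j=s\}\cap\{j:\bar{\mathbf z}^{\ell,-i}_j=\bar{\mathbf z}^{\ell,-i}_i\}\big)$. Output $\hat{\mathbf z}^\star$ and $\hat{\mathbf z}^{(1)},\dots,\hat{\mathbf z}^{(L)}$ (ties broken arbitrarily). Consistent-initialization assumption: there exist $\delta_n=o(1)$ and constants $\varepsilon_{\mathrm{init}}>0$, $C'>0$ such that for every model in $\mathcal P_n$ and every $i\in[n]$, $\mathbb P\big(\min_{\pi\in\{\pm1\}}d_H(\pi\tilde{\mathbf z}^{(-i)},\mathbf z^\star_{-i})>n\delta_n\big)\le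 C'n^{-(1+\varepsilon_{\mathrm{init}})}$, where $\mathbf z^\star_{-i}$ is $\mathbf z^\star$ with coordinate $i$ removed. *)

(* Defs.v *)
From HB Require Import structures.
From mathcomp Require Import all_boot all_order all_algebra.
From mathcomp Require Import all_classical all_reals all_analysis.
Set Implicit Arguments. Unset Strict Implicit. Unset Printing Implicit Defensive.
Import Order.TTheory GRing.Theory Num.Theory.
Local Open Scope ring_scope.

(* Convention: a label in {+1,-1} is encoded as a bool (true = +1, false = -1);
   multiplication of signs is xor ((+)), and -z is negb \o z. *)

Section IMLSBM.
Variable R : realType.

(* An outcome: xi (true means the sign is flipped, probability rho) and the
   edge indicators E(l,i,j), of which only those with i < j are random. *)
Definition imlsbm_outcome (L n : nat) :=
  ({ffun 'I_L * 'I_n -> bool} * {ffun 'I_L * 'I_n * 'I_n -> bool})%type.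

Definition layer_label L n (zs : 'I_n -> bool) (w : imlsbm_outcome L n)
  (l : 'I_L) (i : 'I_n) : bool := zs i (+) w.1 (l, i).

Definition adj_of L n (w : imlsbm_outcome L n) : 'I_L -> 'I_n -> 'I_n -> bool :=
  fun l i j => if (i < j)%N then w.2 (l, i, j)
               else if (j < i)%N then w.2 (l, j, i) else false.

Definition bern (a : R) (b : bool) : R := if b then a else 1 - a.

Definition imlsbm_weight L n (rho : R) (p q : 'I_L -> R) (zs : 'I_n -> bool)
  (w : imlsbm_outcome L n) : R :=
  (\prod_(x : 'I_L * 'I_n) bern rho (w.1 x)) *
  \prod_(y : 'I_L * 'I_n * 'I_n)
     (let: (li, j) := y in let: (l, i) := li in
      if (i < j)%N then
        bern (if layer_label zs w l i == layer_label zs w l j then p l else q l) (w.2 y)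
      else bern 0 (w.2 y)).

Definition imlsbm_prob L n (rho : R) (p q : 'I_L -> R) (zs : 'I_n -> bool)
  (E : imlsbm_outcome L n -> bool) : R :=
  \sum_(w : imlsbm_outcome L n) imlsbm_weight rho p q zs w * (E w)%:R.

Definition in_Pn n (beta : R) (zs : 'I_n -> bool) : Prop :=
  n%:R / (2 * beta) <= #|[set i | zs i]|%:R <= n%:R * beta / 2 /\
  n%:R / (2 * beta) <= #|[set i | ~~ zs i]|%:R <= n%:R * beta / 2.

Definition hamming n (x y : 'I_n -> bool) : nat := #|[set i | x i != y i]|.

Definition loss n (zh z : 'I_n -> bool) : R :=
  (minn (hamming zh z) (hamming (negb \o zh) z))%:R / n%:R.

Definition Iinfo (p q t : R) : R :=
  - ln ((p `^ (1 - t) * q `^ t + (1 - p) `^ (1 - t) * (1 - q) `^ t) *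
        (p `^ t * q `^ (1 - t) + (1 - p) `^ t * (1 - q) `^ (1 - t))).

Definition psiS n L (p q : 'I_L -> R) (S : {set 'I_L}) (t : R) : R :=
  - (n%:R / 2) * \sum_(l in S) Iinfo (p l) (q l) t.

Definition psiS_star n L (p q : 'I_L -> R) (S : {set 'I_L}) (a : R) : R :=
  sup [set x | exists2 t : R, 0 <= t <= 1 & x = a * t - psiS n p q S t].

Definition Jrho (rho : R) : R := - ln (2 * Num.sqrt (rho * (1 - rho))).

Definition Ical n L (rho : R) (p q : 'I_L -> R) (S : {set 'I_L}) : R :=
  let k := #|~: S| in
  if odd k then k.+1%:R * Jrho rho + psiS_star n p q S (- 2 * Jrho rho)
  else k%:R * Jrho rho + psiS_star n p q S 0.

Definition minIcal n L (rho : R) (p q : 'I_L -> R) : R :=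
  \big[Num.min/Ical n rho p q [set: 'I_L]]_(S : {set 'I_L}) Ical n rho p q S.

Definition delete_node L n (i : 'I_n) (A : 'I_L -> 'I_n -> 'I_n -> bool) :
  'I_L -> 'I_n.-1 -> 'I_n.-1 -> bool :=
  fun l a b => A l (lift i a) (lift i b).

(* A vector indexed by [n]\{i}, represented on 'I_n (value at i irrelevant). *)
Definition reindex n (i : 'I_n) (z : 'I_n.-1 -> bool) : 'I_n -> bool :=
  fun j => if unlift i j is Some k then z k else true.

Definition ztilde (L : nat -> nat)
  (Init : forall n, ('I_(L n) -> 'I_n.-1 -> 'I_n.-1 -> bool) -> 'I_n.-1 -> bool)
  n (A : 'I_(L n) -> 'I_n -> 'I_n -> bool) (i : 'I_n) : 'I_n -> bool :=
  reindex i (Init n (delete_node i A)).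

Definition f_score L n (rho : R) (p q : 'I_L -> R) (A : 'I_L -> 'I_n -> 'I_n -> bool)
  (i : 'I_n) (l : 'I_L) (sstar sl : bool) (zt : 'I_n -> bool) : R :=
  ln ((1 - rho) / rho) * (sl == sstar)%:R +
  \sum_(j | (j != i) && (zt j == sl))
     (ln (p l * (1 - q l) / (q l * (1 - p l))) * (A l i j)%:R
      + ln ((1 - p l) / (1 - q l))).

Definition stageII_obj (L : nat -> nat) Init n (rho : R) (p q : 'I_(L n) -> R)
  (A : 'I_(L n) -> 'I_n -> 'I_n -> bool) (i : 'I_n)
  (sstar : bool) (s : 'I_(L n) -> bool) : R :=
  \sum_(l < L n) f_score rho p q A i l sstar (s l) (ztilde Init A i).

(* zhat is a possible global output hat z* of Algorithm 3 on input A
   (for some resolution of the ties in the argmax's of Stages II and III). *)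
Definition alg3_global_output (L : nat -> nat)
  (Init : forall n, ('I_(L n) -> 'I_n.-1 -> 'I_n.-1 -> bool) -> 'I_n.-1 -> bool)
  n (rho : R) (p q : 'I_(L n) -> R) (A : 'I_(L n) -> 'I_n -> 'I_n -> bool)
  (zhat : 'I_n -> bool) : Prop :=
  exists sb : 'I_n -> bool * ('I_(L n) -> bool),
    (forall i (tstar : bool) (t : 'I_(L n) -> bool),
        stageII_obj Init rho p q A i tstar t
        <= stageII_obj Init rho p q A i (sb i).1 (sb i).2) /\
    let zbar (i : 'I_n) : 'I_n -> bool :=
      fun j => if j == i then (sb i).1 else ztilde Init A i j in
    (* Stage III: alignment with respect to node 1 (index 0) *)
    forall i1 : 'I_n, val i1 = 0%N ->
      zhat i1 = zbar i1 i1 /\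
      forall i : 'I_n, val i <> 0%N -> forall s : bool,
        (#|[set j | (zbar i1 j == s) && (zbar i j == zbar i i)]|
        <= #|[set j | (zbar i1 j == zhat i) && (zbar i j == zbar i i)]|)%N.

Definition init_err n (zt : 'I_n -> bool) (zs : 'I_n -> bool) (i : 'I_n) : nat :=
  minn #|[set j | (j != i) && (zt j != zs j)]|
       #|[set j | (j != i) && (~~ zt j != zs j)]|.

End IMLSBM.

(* Main.v *)
(* On the event that all leave-one-out initializations are accurate and few labels
   are flipped in every layer, node i can only be misclassified if
   sum_l c_l <= 0, where c_l truncates the log-likelihood ratio D_l of the edges at
   i in layer l to [-W, W], W = ln ((1 - rho) / rho) >= 2 J.  Sort the layers
   according to whether the label of i is flipped there (c_l >= -W), c_l = W, or
   c_l >= D_l.  Given the flips and the edges not touching i, Chernoff's bound with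
   parameter t for a given sorting yields exp (- (k W (1 - t) + b W t + n/2 sum_S I_t)),
   up to a factor 1 - o(1) for the last term, k and b counting the first two kinds of
   layers and S being the third kind.  As I_t = I_(1-t) is concave, one of t and
   1 - t, moved slightly towards 1/2, makes the exponent at least (1 - o(1)) Ical S:
   the parity term in Ical comes from |k - b| >= 1.
   Summing over the sortings costs only exp (o (min Ical)): if J = O(min Ical), then
   t = 1/2 can be used throughout, where the sum factorizes over the layers, and
   otherwise L <= exp (o (J)).  Markov's inequality concludes. *)
Require Import Defs.
From HB Require Import structures.
From mathcomp Require Import all_boot all_order all_algebra.
From mathcomp Require Import all_classical all_reals all_analysis.
From mathcomp Require Import ring lra.
Import Order.TTheory GRing.Theory Num.Theory.
Import numFieldNormedType.Exports.
Local Open Scope ring_scope.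
Set Implicit Arguments. Unset Strict Implicit. Unset Printing Implicit Defensive.

(** * Product Bernoulli measures and partial resampling *)

Section ProductBernoulli.
Variables (R : realType) (T : finType).
Implicit Types (r : T -> R) (M : pred T) (w : {ffun T -> bool}).

Definition bern_weight r w : R := \prod_y bern (r y) (w y).

Definition bern_exp r (F : {ffun T -> bool} -> R) : R :=
  \sum_w bern_weight r w * F w.

Definition splice M w w' : {ffun T -> bool} :=
  [ffun y => if M y then w' y else w y].

Lemma bern_exp_prod r (g : T -> bool -> R) :
  bern_exp r (fun w => \prod_y g y (w y)) =
  \prod_y (r y * g y true + (1 - r y) * g y false).
Proof.
rewrite /bern_exp /bern_weight /=.
under eq_bigr do rewrite -big_split /=.
rewrite -(bigA_distr_bigA (fun y b => bern (r y) b * g y b)).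
by apply: eq_bigr => y _; rewrite big_bool.
Qed.

Lemma bern_exp_cst r (c : R) : bern_exp r (fun=> c) = c.
Proof.
have h : bern_exp r (fun=> 1) = 1.
  transitivity (bern_exp r (fun w => \prod_y (fun _ _ => 1) y (w y))).
    by apply: eq_bigr => w _; rewrite big1_eq.
  rewrite (bern_exp_prod r (fun _ _ => 1)) big1 // => y _.
  by rewrite !mulr1 addrCA subrr addr0.
rewrite /bern_exp -mulr_suml.
move: h; rewrite /bern_exp; under eq_bigr do rewrite mulr1.
by move=> ->; rewrite mul1r.
Qed.

Lemma bern_weight_ge0 r w : (forall y, 0 <= r y <= 1) -> 0 <= bern_weight r w.
Proof.
move=> r01; apply: prodr_ge0 => y _; rewrite /bern.
by have /andP[r0 r1] := r01 y; case: ifP; rewrite ?subr_ge0.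
Qed.

Lemma bern_exp_le r F G : (forall y, 0 <= r y <= 1) ->
  (forall w, F w <= G w) -> bern_exp r F <= bern_exp r G.
Proof. by move=> r01 FG; apply: ler_sum => w _; rewrite ler_wpM2l ?bern_weight_ge0. Qed.

(* Swapping the coordinates in M between two independent copies preserves the
   product measure. *)
Lemma bern_exp_resample r M F :
  bern_exp r F = bern_exp r (fun w => bern_exp r (fun w' => F (splice M w w'))).
Proof.
transitivity (bern_exp r (fun w => bern_exp r (fun=> F w))).
  by apply: eq_bigr => w _; rewrite bern_exp_cst.
rewrite /bern_exp.
under eq_bigr do rewrite mulr_sumr.
under [RHS]eq_bigr do rewrite mulr_sumr.
rewrite !pair_big /=.
pose sw (x : {ffun T -> bool} * {ffun T -> bool}) := (splice M x.1 x.2, splice M x.2 x.1).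
have swK : involutive sw.
  move=> [u v]; rewrite /sw /=; congr (_, _); apply/ffunP => y; rewrite !ffunE;
  by case: (M y).
rewrite (reindex_inj (inv_inj swK)) /=.
apply: eq_bigr => -[u v] _ /=; rewrite !mulrA; congr (_ * _).
rewrite /bern_weight -!big_split /=; apply: eq_bigr => y _.
by rewrite !ffunE; case: (M y) => //; rewrite mulrC.
Qed.

Lemma bern_expZ r (a : R) F : bern_exp r (fun w => a * F w) = a * bern_exp r F.
Proof. by rewrite /bern_exp mulr_sumr; apply: eq_bigr => w _; rewrite mulrCA. Qed.

(** Conditional Chernoff bound: after resampling the coordinates in [M], the original [w] plays the
    role of the conditioning. Hence the multiplicative majorant [a], [g] may depend on [w], while
    its mean over [w'] factorizes. *)
Lemma bern_exp_cond_le r M F (K : R) : (forall y, 0 <= r y <= 1) ->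
  (forall w, exists (a : R) (g : T -> bool -> R),
     (forall w', F (splice M w w') <= a * \prod_y g y (w' y)) /\
     a * \prod_y (r y * g y true + (1 - r y) * g y false) <= K) ->
  bern_exp r F <= K.
Proof.
move=> r01 H; rewrite (bern_exp_resample r M) -[leRHS](bern_exp_cst r K).
apply: bern_exp_le => // w; have [a [g [Fg gK]]] := H w.
by apply: (le_trans _ gK); rewrite -bern_exp_prod -bern_expZ; exact: bern_exp_le.
Qed.

End ProductBernoulli.

(** * Chernoff coefficients of two Bernoulli laws and moments of one edge *)

Section ChernoffCoefficient.
Variable R : realType.
Implicit Types (a b p q t s : R).

Lemma expR_convex a b t : 0 <= t <= 1 ->
  expR ((1 - t) * a + t * b) <= (1 - t) * expR a + t * expR b.
Proof.
move=> /andP[t0 t1]; set m := (1 - t) * a + t * b.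
have tangent x : expR m * (1 + (x - m)) <= expR x.
  have -> : expR x = expR m * expR (x - m) by rewrite -expRD; congr expR; rewrite addrC subrK.
  by rewrite ler_pM2l ?expR_gt0 // expR_ge1Dx.
have := tangent a; have := tangent b => hb ha.
have t1' : 0 <= 1 - t by lra.
have := ler_wpM2l t1' ha; have := ler_wpM2l t0 hb.
have e : (1 - t) * (1 + (a - m)) + t * (1 + (b - m)) = 1 by rewrite /m; ring.
rewrite -[leLHS]mulr1 -e; move: (expR m) => M; nra.
Qed.

(** For [t <= 1/2] the point is the mixture of [a] and the midpoint of [a] and [b] with weights
    [1 - 2t] and [2t]. Since the exponential at the midpoint is a product of square roots,
    completing the square produces the extra term. *)
Lemma expR_convex_sharp a b t : 0 <= t <= 1 ->
  expR ((1 - t) * a + t * b) + Num.min t (1 - t) * (expR (a / 2) - expR (b / 2)) ^+ 2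
    <= (1 - t) * expR a + t * expR b.
Proof.
wlog t2 : t a b / t <= 1 / 2.
  move=> H /andP[t0 t1]; have [|t2] := leP t (1 / 2).
    by move/H; apply; rewrite t0 t1.
  have := @H (1 - t) b a; rewrite opprB [1 + (t - 1)]addrCA subrr addr0 minC -sqrrN opprB.
  rewrite [t * b + _]addrC [t * expR b + _]addrC; apply; lra.
move=> /andP[t0 _].
have -> : Num.min t (1 - t) = t by apply/min_idPl; lra.
have := @expR_convex a ((a + b) / 2) (2 * t).
have -> : (1 - 2 * t) * a + 2 * t * ((a + b) / 2) = (1 - t) * a + t * b by field.
have -> : expR ((a + b) / 2) = expR (a / 2) * expR (b / 2).
  by rewrite -expRD; congr expR; lra.
have sq (x : R) : expR x = expR (x / 2) ^+ 2 by rewrite expr2 -expRD; congr expR; lra.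
rewrite (sq a) (sq b) => H; have {}H := H ltac:(lra); nra.
Qed.

(** The Chernoff coefficient of Bern(p) and Bern(q), that is, the sum over both outcomes of the
    densities raised to [1 - t] and [t]. The form with [expR] and [ln] gives direct access to
    convexity. *)
Definition chern p q t : R :=
  expR ((1 - t) * ln p + t * ln q) + expR ((1 - t) * ln (1 - p) + t * ln (1 - q)).

Lemma chern_gt0 p q t : 0 < chern p q t.
Proof. by rewrite addr_gt0 ?expR_gt0. Qed.

Lemma Iinfo_chern p q t : 0 < q < p -> p < 1 ->
  Iinfo p q t = - ln (chern p q t) - ln (chern p q (1 - t)).
Proof.
move=> /andP[q0 qp] p1; rewrite -opprD -lnM ?posrE ?chern_gt0 //.
have pw (a b u v : R) : 0 < a -> 0 < b -> a `^ u * b `^ v = expR (u * ln a + v * ln b).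
  by move=> a0 b0; rewrite /powR !gt_eqF // expRD.
by rewrite /Iinfo /chern !pw; try lra; rewrite opprB [1 + (t - 1)]addrCA subrr addr0.
Qed.

(** The sharp inequality is used for the outcome 1 and plain convexity for the outcome 0. What
    remains is the squared difference of the roots of [p] and [q], whose sum is at most twice the
    root of [p]. *)
Lemma chern_gap p q t : 0 < q < p -> p < 1 -> 0 <= t <= 1 ->
  Num.min t (1 - t) * ((p - q) ^+ 2 / (4 * p)) <= 1 - chern p q t.
Proof.
move=> /andP[q0 qp] p1 t01.
have t0 : 0 <= Num.min t (1 - t) by rewrite le_min; lra.
have H1 := expR_convex_sharp (ln p) (ln q) t01.
have H2 := expR_convex (ln (1 - p)) (ln (1 - q)) t01.
have eln (x : R) : 0 < x -> expR (ln x) = x by move=> x0; rewrite lnK ?posrE.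
rewrite (eln p) ?(eln q) in H1; [|lra..].
rewrite (eln (1 - p)) ?(eln (1 - q)) in H2; [|lra..].
rewrite /chern.
have sq (x : R) : 0 < x -> expR (ln x / 2) ^+ 2 = x.
  move=> x0; rewrite -[RHS](eln _ x0) expr2 -expRD; congr expR; lra.
have H3 : (p - q) ^+ 2 / (4 * p) <= (expR (ln p / 2) - expR (ln q / 2)) ^+ 2.
  rewrite ler_pdivrMr; last lra.
  have : expR (ln q / 2) <= expR (ln p / 2).
    by rewrite ler_expR ler_pM2r ?ler_ln ?posrE; lra.
  have : 0 < expR (ln q / 2) by rewrite expR_gt0.
  move: (sq p (lt_trans q0 qp)) (sq q q0).
  move: (expR (ln p / 2)) (expR (ln q / 2)) => x y <- <- y0 yx.
  have -> : (x ^+ 2 - y ^+ 2) ^+ 2 = (x - y) ^+ 2 * (x + y) ^+ 2 by ring.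
  rewrite ler_wpM2l ?sqr_ge0 //.
  have -> : 4 * x ^+ 2 = (2 * x) ^+ 2 by ring.
  by rewrite ler_sqr ?nnegrE; lra.
have := ler_wpM2l t0 H3; lra.
Qed.

Lemma chern_le1 p q t : 0 < q < p -> p < 1 -> 0 <= t <= 1 -> chern p q t <= 1.
Proof.
move=> qp p1 t01; rewrite -subr_ge0; apply: le_trans (chern_gap qp p1 t01).
rewrite mulr_ge0 ?le_min ?divr_ge0 ?sqr_ge0 //; lra.
Qed.

Lemma ln_chern_le0 p q t : 0 < q < p -> p < 1 -> 0 <= t <= 1 -> ln (chern p q t) <= 0.
Proof. by move=> qp p1 t01; apply: ln_le0; exact: chern_le1. Qed.

Lemma Iinfo_ge0 p q t : 0 < q < p -> p < 1 -> 0 <= t <= 1 -> 0 <= Iinfo p q t.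
Proof.
move=> qp p1 t01; rewrite Iinfo_chern //.
have := ln_chern_le0 qp p1 t01.
have := @ln_chern_le0 p q (1 - t) qp p1; lra.
Qed.

Lemma Iinfo_sym p q t : 0 < q < p -> p < 1 -> Iinfo p q (1 - t) = Iinfo p q t.
Proof.
move=> qp p1; rewrite !Iinfo_chern // opprB [1 + (t - 1)]addrCA subrr addr0; lra.
Qed.

(** Hölder's inequality: divide the terms of the two coefficients by [F] and [G], apply convexity of
    the exponential termwise, and add up. *)
Lemma ln_chern_convex p q t s v : 0 <= v <= 1 ->
  ln (chern p q ((1 - v) * t + v * s)) <=
  (1 - v) * ln (chern p q t) + v * ln (chern p q s).
Proof.
move=> v01; rewrite -ler_expR lnK ?posrE ?chern_gt0 //.
rewrite {1}/chern; set F := chern p q t; set G := chern p q s.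
have F0 : 0 < F := chern_gt0 _ _ _.
have G0 : 0 < G := chern_gt0 _ _ _.
rewrite -[leRHS]mul1r.
have term a b : expR ((1 - ((1 - v) * t + v * s)) * a + ((1 - v) * t + v * s) * b) <=
    ((1 - v) * (expR ((1 - t) * a + t * b) / F) + v * (expR ((1 - s) * a + s * b) / G))
      * expR ((1 - v) * ln F + v * ln G).
  have := expR_convex ((1 - t) * a + t * b - ln F) ((1 - s) * a + s * b - ln G) v01.
  rewrite !expRB !lnK ?posrE //.
  move/(ler_wpM2r (expR_ge0 ((1 - v) * ln F + v * ln G))); apply: le_trans.
  by rewrite -expRD ler_expR le_eqVlt; apply/orP; left; apply/eqP; ring.
apply: le_trans (lerD (term _ _) (term _ _)) _.
rewrite -mulrDl ler_wpM2r ?expR_ge0 //.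
rewrite addrACA -!mulrDr -!mulrDl -/(chern p q t) -/(chern p q s) -/F -/G.
by rewrite !divff ?gt_eqF //; lra.
Qed.

Lemma Iinfo_concave p q t s v : 0 < q < p -> p < 1 -> 0 <= v <= 1 ->
  (1 - v) * Iinfo p q t + v * Iinfo p q s <= Iinfo p q ((1 - v) * t + v * s).
Proof.
move=> qp p1 v01; rewrite !Iinfo_chern //.
have := ln_chern_convex p q t s v01.
have := ln_chern_convex p q (1 - t) (1 - s) v01.
have -> : (1 - v) * (1 - t) + v * (1 - s) = 1 - ((1 - v) * t + v * s) by ring.
lra.
Qed.

Lemma Iinfo_le_half p q t : 0 < q < p -> p < 1 -> Iinfo p q t <= Iinfo p q (1 / 2).
Proof.
move=> qp p1; have := @Iinfo_concave p q t (1 - t) (1 / 2) qp p1.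
have -> : (1 - 1 / 2) * t + 1 / 2 * (1 - t) = 1 / 2 by field.
rewrite Iinfo_sym // => /(_ ltac:(lra)); lra.
Qed.

(** The left side bounds the log-moment of an edge whose type is misjudged, so such an edge costs at
    most a constant multiple of the information. The proof adds [chern_gap] at [t] and at [1 - t],
    using [- ln x >= 1 - x] and [p <= C * q]. *)
Lemma Iinfo_lower p q t (tau C : R) : 0 < q < p -> p < 1 -> p <= C * q ->
  0 < tau -> tau <= t <= 1 - tau ->
  2 * (p - q) ^+ 2 / q <= 4 * C / tau * Iinfo p q t.
Proof.
move=> qp p1 pC tau0 ttau; rewrite Iinfo_chern //.
have lnle (x : R) : 0 < x -> ln x <= x - 1.
  by move=> x0; rewrite -{1}(subrK 1 x) addrC le_ln1Dx //; lra.
have K u : tau <= u <= 1 - tau -> tau * ((p - q) ^+ 2 / (4 * p)) <= - ln (chern p q u).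
  move=> uu; have := @chern_gap p q u qp p1; have := lnle _ (chern_gt0 p q u).
  have h : tau <= Num.min u (1 - u) by rewrite le_min; lra.
  have g : 0 <= (p - q) ^+ 2 / (4 * p) by rewrite divr_ge0 ?sqr_ge0 //; lra.
  have := ler_wpM2r g h; move=> h1 h2 h3; have {}h3 := h3 ltac:(lra); lra.
have K1 := K _ ttau; have K2 := K (1 - t) ltac:(lra).
have [q0 C0] : 0 < q /\ 0 < C by split; [lra | nra].
have -> : 2 * (p - q) ^+ 2 / q = 4 * C / tau * (2 * (tau * ((p - q) ^+ 2 / (4 * (C * q))))).
  by field; rewrite !gt_eqF.
apply: ler_wpM2l; first by rewrite divr_ge0; lra.
have : (p - q) ^+ 2 / (4 * (C * q)) <= (p - q) ^+ 2 / (4 * p).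
  by rewrite ler_wpM2l ?sqr_ge0 // lef_pV2 ?posrE; nra.
move/(ler_wpM2l (ltW tau0)); lra.
Qed.

Definition edge_llr p q (x : bool) : R :=
  ln (p * (1 - q) / (q * (1 - p))) * x%:R + ln ((1 - p) / (1 - q)).

Lemma edge_llrE p q x : 0 < q < p -> p < 1 ->
  edge_llr p q x = if x then ln p - ln q else ln (1 - p) - ln (1 - q).
Proof.
move=> qp p1; rewrite /edge_llr !ln_div ?lnM ?posrE; try nra.
by case: x => /=; rewrite ?mulr1 ?mulr0; lra.
Qed.

(** The flag [x] tells whether the endpoints have equal labels, that is, whether the edge is Bern(p)
    rather than Bern(q). *)
Definition edge_mgf p q (x : bool) s : R :=
  let r := if x then p else q in
  r * expR (s * edge_llr p q true) + (1 - r) * expR (s * edge_llr p q false).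

Lemma edge_mgf_match_pos p q t : 0 < q < p -> p < 1 ->
  edge_mgf p q true (- t) = chern p q t.
Proof.
move=> qp p1; rewrite /edge_mgf !edge_llrE // /chern.
rewrite -[in X in X * _ + _](@lnK _ p) ?posrE; last lra.
rewrite -[X in _ + X * _](@lnK _ (1 - p)) ?posrE; last lra.
by rewrite -!expRD; congr (expR _ + expR _); ring.
Qed.

Lemma edge_mgf_match_neg p q t : 0 < q < p -> p < 1 ->
  edge_mgf p q false t = chern p q (1 - t).
Proof.
move=> qp p1; rewrite /edge_mgf !edge_llrE // /chern.
rewrite -[in X in X * _ + _](@lnK _ q) ?posrE; last lra.
rewrite -[X in _ + X * _](@lnK _ (1 - q)) ?posrE; last lra.
by rewrite -!expRD; congr (expR _ + expR _); ring.
Qed.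

(** By convexity a power [t] of a likelihood ratio is at most [1 - t] plus [t] times the ratio. The
    mean of the ratio under the wrong law is 1 plus a chi-square divergence, and [p <= 1/2]
    simplifies its denominator. *)
Lemma edge_mgf_mismatch_pos p q t : 0 < q < p -> p <= 1 / 2 -> 0 <= t <= 1 ->
  edge_mgf p q false (- t) <= expR (2 * (p - q) ^+ 2 / q).
Proof.
move=> qp p1 t01; have p1' : p < 1 by lra.
rewrite /edge_mgf !edge_llrE //.
have c (a b : R) : 0 < a -> 0 < b -> expR (- t * (ln a - ln b)) <= (1 - t) + t * (b / a).
  move=> a0 b0; have := expR_convex 0 (ln b - ln a) t01.
  rewrite expR0 expRB !lnK ?posrE // mulr0 add0r mulr1.
  by apply: le_trans; rewrite ler_expR; lra.
have h1 := c p q ltac:(lra) ltac:(lra).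
have h2 := c (1 - p) (1 - q) ltac:(lra) ltac:(lra).
apply: le_trans (expR_ge1Dx _).
have q0 : 0 <= q by lra.
have q1 : 0 <= 1 - q by lra.
apply: le_trans (lerD (ler_wpM2l q0 h1) (ler_wpM2l q1 h2)) _.
have -> : q * (1 - t + t * (q / p)) + (1 - q) * (1 - t + t * ((1 - q) / (1 - p))) =
  1 + t * ((p - q) ^+ 2 / (p * (1 - p))) by field; apply/andP; split; apply/eqP; lra.
rewrite lerD2l.
have : (p - q) ^+ 2 / (p * (1 - p)) <= 2 * (p - q) ^+ 2 / q.
  rewrite ler_pdivrMr; last nra.
  have -> : 2 * (p - q) ^+ 2 / q * (p * (1 - p)) = (p - q) ^+ 2 * (p / q * (2 * (1 - p))).
    by field; apply/eqP; lra.
  rewrite ler_peMr ?sqr_ge0 //.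
  have : 1 <= p / q by rewrite ler_pdivlMr; lra.
  nra.
have : 0 <= (p - q) ^+ 2 / (p * (1 - p)) by rewrite divr_ge0 ?sqr_ge0 //; nra.
nra.
Qed.

Lemma edge_mgf_mismatch_neg p q t : 0 < q < p -> p <= 1 / 2 -> 0 <= t <= 1 ->
  edge_mgf p q true t <= expR (2 * (p - q) ^+ 2 / q).
Proof.
move=> qp p1 t01; have p1' : p < 1 by lra.
rewrite /edge_mgf !edge_llrE //.
have c (a b : R) : 0 < a -> 0 < b -> expR (t * (ln a - ln b)) <= (1 - t) + t * (a / b).
  move=> a0 b0; have := expR_convex 0 (ln a - ln b) t01.
  by rewrite expR0 expRB !lnK ?posrE // mulr0 add0r mulr1.
have h1 := c p q ltac:(lra) ltac:(lra).
have h2 := c (1 - p) (1 - q) ltac:(lra) ltac:(lra).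
apply: le_trans (expR_ge1Dx _).
have q0 : 0 <= p by lra.
have q1 : 0 <= 1 - p by lra.
apply: le_trans (lerD (ler_wpM2l q0 h1) (ler_wpM2l q1 h2)) _.
have -> : p * (1 - t + t * (p / q)) + (1 - p) * (1 - t + t * ((1 - p) / (1 - q))) =
  1 + t * ((p - q) ^+ 2 / (q * (1 - q))) by field; apply/andP; split; apply/eqP; lra.
rewrite lerD2l.
have : (p - q) ^+ 2 / (q * (1 - q)) <= 2 * (p - q) ^+ 2 / q.
  rewrite ler_pdivrMr; last nra.
  have -> : 2 * (p - q) ^+ 2 / q * (q * (1 - q)) = (p - q) ^+ 2 * (2 * (1 - q)).
    by field; apply/eqP; lra.
  rewrite ler_peMr ?sqr_ge0 //; lra.
have : 0 <= (p - q) ^+ 2 / (q * (1 - q)) by rewrite divr_ge0 ?sqr_ge0 //; nra.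
nra.
Qed.

End ChernoffCoefficient.

(** * The cost of a label flip *)

Section FlipCost.
Variable R : realType.
Implicit Types rho : R.

Definition flip_llr rho : R := ln ((1 - rho) / rho).

Lemma Jrho_sq rho : 0 < rho < 1 -> expR (- (2 * Jrho rho)) = 4 * (rho * (1 - rho)).
Proof.
move=> r01; have r0 : 0 < rho * (1 - rho) by nra.
rewrite /Jrho mulrN opprK [2 * ln _]mulr_natl mulr2n expRD lnK ?posrE ?mulr_gt0 ?sqrtr_gt0 //.
rewrite mulrACA -!expr2 sqr_sqrtr ?ltW //; ring.
Qed.

Lemma Jrho_gt0 rho : 0 < rho < 1 / 2 -> 0 < Jrho rho.
Proof.
move=> r01; have : expR (- (2 * Jrho rho)) < 1 by rewrite Jrho_sq; [nra | lra].
rewrite expR_lt1; lra.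
Qed.

Lemma expRN_flip_llr rho : 0 < rho < 1 -> expR (- flip_llr rho) = rho / (1 - rho).
Proof.
move=> r01; rewrite /flip_llr -lnV ?posrE ?divr_gt0; [|lra..].
by rewrite lnK ?posrE ?invf_div ?divr_gt0; lra.
Qed.

(** After exponentiation this compares [rho / (1 - rho)] with [4 * rho * (1 - rho)]; it holds
    because [1 - rho >= 1/2]. *)
Lemma flip_llr_ge rho : 0 < rho < 1 / 2 -> 2 * Jrho rho <= flip_llr rho.
Proof.
move=> r01; rewrite -lerN2 -ler_expR expRN_flip_llr ?Jrho_sq; [|lra..].
rewrite ler_pdivrMr; last lra.
have : 1 <= 4 * (1 - rho) ^+ 2 by nra.
have : 0 < rho by lra.
nra.
Qed.

Lemma le_expRN_flip_llr rho : 0 < rho < 1 / 2 -> rho <= expR (- flip_llr rho).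
Proof. by move=> r01; rewrite expRN_flip_llr ?ler_pdivlMr; nra. Qed.

End FlipCost.

Lemma sum_option_bool (V : nmodType) (F : option bool -> V) :
  \sum_c F c = F None + (F (Some true) + F (Some false)).
Proof.
rewrite (bigD1 None) //= (bigD1 (Some true)) //=; congr (_ + (_ + _)).
by apply: big_pred1 => -[[]|].
Qed.

(** * Exponents of the layer classes and their sum *)

Section LayerClasses.
Variables (R : realType) (n L : nat) (rho : R) (p q : 'I_L -> R).
Hypothesis rho01 : 0 < rho < 1 / 2.
Hypothesis pq01 : forall l, 0 < q l < p l /\ p l < 1.

Local Notation W := (flip_llr rho).
Local Notation J := (Jrho rho).
Local Notation Y t l := (n%:R / 2 * Iinfo (p l) (q l) t).

(* Class of a layer: [Some true] if the label of the node is flipped there,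
   [Some false] if it is not and the log-likelihood ratio is at least W, [None]
   otherwise. *)
Definition class_cost (eta t : R) (l : 'I_L) (c : option bool) : R :=
  match c with
  | Some true => W * (1 - t)
  | Some false => W * t
  | None => (1 - eta) * Y t l
  end.

Definition free_layers (f : {ffun 'I_L -> option bool}) : {set 'I_L} :=
  [set l | f l == None].

Lemma Y_ge0 t l : 0 <= t <= 1 -> 0 <= Y t l.
Proof.
move=> t01; have [qp p1] := pq01 l.
by rewrite mulr_ge0 ?Iinfo_ge0 // divr_ge0.
Qed.

Lemma psiS_starP (S : {set 'I_L}) a b :
  (forall t, 0 <= t <= 1 -> a * t + \sum_(l in S) Y t l <= b) ->
  psiS_star n p q S a <= b.
Proof.
move=> H; apply: ge_sup.
  by exists (a * 0 - psiS n p q S 0), 0; rewrite // lexx ler01.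
move=> _ [t t01 ->]; apply: le_trans (H t t01).
by rewrite lerD2l /psiS mulNr opprK mulr_sumr.
Qed.

Lemma sumY_le_half (S : {set 'I_L}) t :
  \sum_(l in S) Y t l <= \sum_(l in S) Y (1 / 2) l.
Proof.
apply: ler_sum => l _; have [qp p1] := pq01 l.
by apply: ler_wpM2l; rewrite ?divr_ge0 // Iinfo_le_half.
Qed.

Lemma psiS_star_ge (S : {set 'I_L}) a t : a <= 0 -> 0 <= t <= 1 ->
  a * t + \sum_(l in S) Y t l <= psiS_star n p q S a.
Proof.
move=> a0 t01; apply: ub_le_sup; last first.
  by exists t => //; congr (_ + _); rewrite /psiS mulNr opprK mulr_sumr.
(* The set is bounded above because [a * u <= 0] and the information is largest at 1/2. *)
exists (\sum_(l in S) Y (1 / 2) l) => _ [u u01 ->].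
rewrite /psiS mulNr opprK mulr_sumr.
apply: le_trans (sumY_le_half S u); rewrite gerDr; nra.
Qed.

(** The parity correction is worth at most one [J]. *)
Lemma Ical_le (S : {set 'I_L}) :
  Ical n rho p q S <= #|~: S|%:R * J + J + \sum_(l in S) Y (1 / 2) l.
Proof.
have J0 := Jrho_gt0 rho01.
rewrite /Ical; case: ifP => _.
  have := @psiS_starP S (- 2 * J) (\sum_(l in S) Y (1 / 2) l).
  rewrite -[#|_|.+1%:R]natr1 => H; have {}H := H ltac:(move=> t t01; have := sumY_le_half S t; nra).
  lra.
have := @psiS_starP S 0 (\sum_(l in S) Y (1 / 2) l).
move=> H; have {}H := H ltac:(move=> t t01; have := sumY_le_half S t; nra).
lra.
Qed.

Lemma Ical_ge_card (S : {set 'I_L}) : #|~: S|%:R * J <= Ical n rho p q S.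
Proof.
have J0 := Jrho_gt0 rho01.
have Y0 : 0 <= \sum_(l in S) Y (1 / 2) l by apply: sumr_ge0 => l _; apply: Y_ge0; lra.
rewrite /Ical; case: ifP => _.
  have := @psiS_star_ge S (- 2 * J) (1 / 2); rewrite -[#|_|.+1%:R]natr1.
  move=> H; have {}H := H ltac:(lra) ltac:(lra); lra.
have := @psiS_star_ge S 0 (1 / 2) => H; have {}H := H ltac:(lra) ltac:(lra); lra.
Qed.

Lemma minIcal_le (S : {set 'I_L}) : minIcal n rho p q <= Ical n rho p q S.
Proof. exact: bigmin_le. Qed.

(** Taking logarithms makes a bound for every [t] a bound for the supremum in [psiS_star], so no
    maximizer has to be found. *)
Lemma le_expRN_Ical (S : {set 'I_L}) (theta X : R) : 0 < theta ->
  (forall t, 0 <= t <= 1 -> X <= expR (- (theta *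
     (if odd #|~: S| then #|~: S|.+1%:R * J - 2 * J * t + \sum_(l in S) Y t l
      else #|~: S|%:R * J + \sum_(l in S) Y t l)))) ->
  X <= expR (- (theta * Ical n rho p q S)).
Proof.
move=> th0 H; have [X0|X0] := leP X 0; first exact: le_trans X0 (expR_ge0 _).
rewrite -[leLHS]lnK ?posrE // ler_expR lerNr -ler_pdivlMl // mulrC.
have {}H t : 0 <= t <= 1 -> (if odd #|~: S|
     then #|~: S|.+1%:R * J - 2 * J * t + \sum_(l in S) Y t l
     else #|~: S|%:R * J + \sum_(l in S) Y t l) <= - ln X / theta.
  by move/H; rewrite -{1}[X]lnK ?posrE // ler_expR lerNr -ler_pdivlMl // [theta^-1 * _]mulrC.
rewrite /Ical; move: H; case: ifP => _ H; rewrite addrC -lerBrDr; apply: psiS_starP => t t01;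
  have := H t t01; lra.
Qed.

Lemma class_cost_sum eta t (f : {ffun 'I_L -> option bool}) :
  \sum_l class_cost eta t l (f l) =
  #|[set l | f l == Some true]|%:R * (W * (1 - t)) +
  #|[set l | f l == Some false]|%:R * (W * t) +
  (1 - eta) * \sum_(l in free_layers f) Y t l.
Proof.
have cnt (P : pred 'I_L) (c : R) : #|[set l | P l]|%:R * c = \sum_l (if P l then c else 0).
  by rewrite mulr_natl -sumr_const big_mkcond; apply: eq_bigr => l _; rewrite inE.
rewrite !cnt mulr_sumr [X in _ + _ + X]big_mkcond -!big_split /=.
apply: eq_bigr => l _; rewrite inE; case: (f l) => [[]|] /=;
by rewrite ?addr0 ?add0r.
Qed.

Lemma card_classes (f : {ffun 'I_L -> option bool}) :
  #|~: free_layers f| =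
  (#|[set l | f l == Some true]| + #|[set l | f l == Some false]|)%N.
Proof.
rewrite -cardsUI [X in (_ + X)%N](_ : _ = 0%N) ?addn0; last first.
  by apply/eqP; rewrite cards_eq0; apply/eqP/setP => l; rewrite !inE; case: (f l) => [[]|].
by congr #|pred_of_set _|; apply/setP => l; rewrite !inE; case: (f l) => [[]|].
Qed.

Lemma Iinfo_shift t v l : 0 <= t <= 1 -> 0 <= v <= 1 ->
  (1 - v) * Y t l <= Y ((1 - v) * t + v * (1 / 2)) l.
Proof.
move=> t01 v01; have [qp p1] := pq01 l.
rewrite mulrCA ler_wpM2l ?divr_ge0 //.
apply: le_trans (Iinfo_concave _ _ qp p1 v01); rewrite lerDl mulr_ge0 ?Iinfo_ge0 //; lra.
Qed.

Lemma class_bound (eta lam X : R) (f : {ffun 'I_L -> option bool}) :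
  0 <= eta < 1 -> 0 < lam < 1 ->
  (forall t, lam / 2 <= t <= 1 - lam / 2 ->
     X <= expR (- \sum_l class_cost eta t l (f l))) ->
  X <= expR (- ((1 - eta) * (1 - lam) * Ical n rho p q (free_layers f))).
Proof.
move=> eta01 lam01 HX; have J0 := Jrho_gt0 rho01; have W2J := flip_llr_ge rho01.
apply: le_expRN_Ical => [|t t01]; first by apply: mulr_gt0; lra.
set S := free_layers f; set k := #|[set l | f l == Some true]|.
set b := #|[set l | f l == Some false]|; rewrite card_classes -/k -/b.
(* Moving [t] towards 1/2 brings it into the range where [HX] applies; by concavity the information
   loses only a factor [1 - lam]. *)
pose t1 := (1 - lam) * t + lam * (1 / 2).
have t1b : lam / 2 <= t1 <= 1 - lam / 2 by rewrite /t1; apply/andP; split; nra.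
have Yt1 : (1 - lam) * \sum_(l in S) Y t l <= \sum_(l in S) Y t1 l.
  by rewrite mulr_sumr; apply: ler_sum => l _; apply: Iinfo_shift; lra.
have [u [u2 ut1 ub Yu]] : exists u, [/\ u <= 1 / 2, u <= t1, lam / 2 <= u &
    \sum_(l in S) Y u l = \sum_(l in S) Y t1 l].
  have [h|h] := leP t1 (1 / 2); first by exists t1; split; lra.
  exists (1 - t1); split; try lra.
  by apply: eq_bigr => l _; have [qp p1] := pq01 l; rewrite Iinfo_sym.
have Yu' : \sum_(l in S) Y (1 - u) l = \sum_(l in S) Y t1 l.
  by rewrite -Yu; apply: eq_bigr => l _; have [qp p1] := pq01 l; rewrite Iinfo_sym.
have Y0 : 0 <= \sum_(l in S) Y t l by apply: sumr_ge0 => l _; exact: Y_ge0.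
set y := \sum_(l in S) Y t l in Yt1 Y0 *.
set y1 := \sum_(l in S) Y t1 l in Yt1 Yu Yu' *.
(* Apply the hypothesis at [u] if [k >= b] and at [1 - u] otherwise, so that the larger count always
   gets the larger weight [1 - u]. *)
have {HX} HX : X <= expR (- (W * ((k + b)%:R / 2 + `|k%:R - b%:R| * (1 / 2 - u))
                      + (1 - eta) * y1)).
  have [kb|kb] := leP (b%:R : R) k%:R.
    apply: (le_trans (HX u _)); first lra.
    rewrite ler_expR lerN2 class_cost_sum -/k -/b -/S Yu ger0_norm ?subr_ge0 // natrD; lra.
  apply: (le_trans (HX (1 - u) _)); first lra.
  rewrite ler_expR lerN2 class_cost_sum -/k -/b -/S Yu' ltr0_norm ?subr_lt0 // natrD; lra.
apply: (le_trans HX); rewrite ler_expR lerN2 => {HX}.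
have eta0 : 0 <= 1 - eta by lra.
have := ler_wpM2l eta0 Yt1.
have kb0 : 0 <= (k + b)%:R :> R by [].
case: ifP => [odd_kb|_] hY.
  have kb1 : 1 <= `|k%:R - b%:R| :> R.
    have [kb|kb|kb] := ltngtP k b.
    - by rewrite ltr0_norm ?subr_lt0 ?ltr_nat // opprB lerBrDl natr1 ler_nat.
    - by rewrite gtr0_norm ?subr_gt0 ?ltr_nat // lerBrDl natr1 ler_nat.
    - by move: odd_kb; rewrite kb addnn odd_double.
  have h1 : (k + b)%:R / 2 + (1 / 2 - u) <=
    (k + b)%:R / 2 + `|k%:R - b%:R| * (1 / 2 - u) :> R by nra.
  have h2 : 2 * J * ((k + b)%:R / 2 + (1 / 2 - u)) <=
    W * ((k + b)%:R / 2 + `|k%:R - b%:R| * (1 / 2 - u)).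
    by apply: ler_pM; lra.
  have h3 : (1 - lam) * ((k + b).+1%:R * J - 2 * J * t) <=
     2 * J * ((k + b)%:R / 2 + (1 / 2 - u)).
    rewrite -[(k + b).+1%:R]natr1; have : 2 * J * u <= 2 * J * t1 by rewrite ler_pM2l; lra.
    have : 0 <= lam * J * (k + b)%:R by rewrite !mulr_ge0 //; lra.
    by rewrite /t1; lra.
  (* Nonnegativity allows this part to be multiplied by [1 - eta], a factor that so far only the
     information terms carry. *)
  have h4 : 0 <= (1 - lam) * ((k + b).+1%:R * J - 2 * J * t).
    have kb2 : 1 <= (k + b)%:R :> R by rewrite ler1n; move: odd_kb; case: (k + b)%N.
    by rewrite -[(k + b).+1%:R]natr1; apply: mulr_ge0; nra.
  have : (1 - eta) * ((1 - lam) * ((k + b).+1%:R * J - 2 * J * t)) <=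
     (1 - lam) * ((k + b).+1%:R * J - 2 * J * t) by apply: ler_piMl => //; lra.
  lra.
have h2 : 2 * J * ((k + b)%:R / 2) <=
    W * ((k + b)%:R / 2 + `|k%:R - b%:R| * (1 / 2 - u)).
  apply: ler_pM => //; rewrite ?lerDl ?mulr_ge0 //; lra.
have h4 : 0 <= (k + b)%:R * J by rewrite mulr_ge0 // ltW.
have h5 : (1 - eta) * (1 - lam) <= 1 by nra.
have := ler_wpM2r h4 h5.
lra.
Qed.

(** The sum over the three classes of one layer. If [y <= (1 - c) * J0], the two [J0] terms are a
    relative error [2 * expR (- (c * J0))]; otherwise all terms are at most the exponential of minus
    the minimum, and the factor 3 is absorbed by [eta]. The error, added over the layers, is where
    [L * expR (- (c * J))] enters. *)
Lemma expR_min_bound (J0 y eta c : R) : 0 < J0 -> 0 < c < 1 -> 0 < eta < 1 -> 0 <= y ->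
  ln 3 <= eta * ((1 - c) * J0) ->
  2 * expR (- J0) + expR (- y) <=
  expR (- ((1 - eta) * Num.min J0 y) + 2 * expR (- (c * J0))).
Proof.
move=> J00 c01 eta01 y0 H; have [yJ|yJ] := leP y ((1 - c) * J0).
  have -> : Num.min J0 y = y by apply/min_idPr; nra.
  apply: (@le_trans _ _ (expR (- y) * (1 + 2 * expR (- (c * J0))))).
    rewrite mulrDr mulr1 addrC lerD2l mulrCA ler_pM2l // -expRD ler_expR; lra.
  apply: (le_trans (ler_wpM2l (expR_ge0 _) (expR_ge1Dx _))).
  by rewrite -expRD ler_expR; nra.
set m := Num.min J0 y.
have m0 : (1 - c) * J0 <= m by rewrite le_min; nra.
apply: (@le_trans _ _ (3 * expR (- m))).
  have : expR (- J0) <= expR (- m) by rewrite ler_expR lerN2 ge_min lexx.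
  have : expR (- y) <= expR (- m) by rewrite ler_expR lerN2 ge_min lexx orbT.
  lra.
rewrite -[3 in X in X <= _]lnK ?posrE // -expRD ler_expR.
have := expR_ge0 (- (c * J0)).
have : eta * ((1 - c) * J0) <= eta * m by rewrite ler_pM2l; lra.
lra.
Qed.

Lemma class_sum_bound (eta c : R) (P : {ffun 'I_L -> option bool} -> R) :
  let M := minIcal n rho p q in
  0 < eta <= 1 / 4 -> 0 < c < 1 ->
  ln 3 <= eta * ((1 - c) * J) ->
  2 * (L%:R * expR (- (c * J))) <= eta * M ->
  (0 < L)%N -> ln L%:R <= eta ^+ 2 * M -> 2 <= eta * M ->
  (forall f t, eta / 2 <= t <= 1 - eta / 2 ->
     P f <= expR (- \sum_l class_cost eta t l (f l))) ->
  \sum_f P f <= expR (- ((1 - 4 * eta) * M)).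
Proof.
move=> M eta01 c01 HJ HL L0 HlnL HM HP; have J0 := Jrho_gt0 rho01.
have M0 : 0 <= M by nra.
have [MJ|MJ] := leP J (eta * M).
  (* The parity terms of Ical amount to at most J, which is negligible here. *)
  have step1 : \sum_f P f <= \prod_l \sum_(cl : option bool) expR (- class_cost eta (1 / 2) l cl).
    rewrite bigA_distr_bigA /=; apply: ler_sum => f _.
    by apply: (le_trans (HP f (1 / 2) _)); [lra | rewrite -sumrN expR_sum].
  apply: (le_trans step1) => {step1 HP}.
  pose y l := (1 - eta) * Y (1 / 2) l.
  have y0 l : 0 <= y l by rewrite mulr_ge0 ?Y_ge0; lra.
  have step2 l : \sum_(cl : option bool) expR (- class_cost eta (1 / 2) l cl) <=
      expR (- ((1 - eta) * Num.min J (y l)) + 2 * expR (- (c * J))).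
    apply: le_trans (expR_min_bound J0 c01 _ (y0 l) HJ); last lra.
    rewrite sum_option_bool /= addrC lerD2r.
    have : expR (- (W * (1 / 2))) <= expR (- J).
      by rewrite ler_expR; have := flip_llr_ge rho01; lra.
    have -> : (1 - 1 / 2 : R) = 1 / 2 by field.
    lra.
  apply: (@le_trans _ _ (\prod_l expR (- ((1 - eta) * Num.min J (y l)) + 2 * expR (- (c * J))))).
    by apply: ler_prod => l _; rewrite step2 andbT sumr_ge0 // => cl _; exact: expR_ge0.
  rewrite -expR_sum ler_expR big_split /= sumr_const card_ord -mulr_natl.
  rewrite sumrN -mulr_sumr.
  (* The layers where the minimum is attained by the information; with this set the sum of minima is
     comparable to [Ical] of [T] up to one [J]. *)
  pose T := [set l | Y (1 / 2) l <= J].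
  have minT : (1 - eta) * (#|~: T|%:R * J + \sum_(l in T) Y (1 / 2) l) <=
     \sum_l Num.min J (y l).
    rewrite mulr_natl -sumr_const mulrDr !mulr_sumr.
    rewrite [X in _ <= X](bigID (mem (~: T))) /=; apply: lerD.
      apply: ler_sum => l; rewrite !inE -ltNge => lJ; rewrite le_min /y; nra.
    rewrite [leLHS](eq_bigl (fun l => l \notin ~: T)); last by move=> l; rewrite !inE negbK.
    apply: ler_sum => l; rewrite !inE negbK => lJ; rewrite le_min lexx andbT.
    by have := @Y_ge0 (1 / 2) l; nra.
  have IT := Ical_le T; have MT := minIcal_le T; rewrite -/M in MT.
  have : (1 - eta) * ((1 - eta) * M) <= \sum_l Num.min J (y l).
    apply: le_trans minT; rewrite ler_pM2l; lra.
  move=> h; have h' : (1 - eta) * ((1 - eta) * ((1 - eta) * M)) <=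
     (1 - eta) * \sum_l Num.min J (y l) by rewrite ler_pM2l; lra.
  have : (1 - 3 * eta) * M <= (1 - eta) * ((1 - eta) * ((1 - eta) * M)).
    by rewrite !mulrA ler_wpM2r //; nra.
  lra.
(* Now [eta * M < J], hence [ln L <= eta ^+ 2 * M <= eta * J]. *)
have LJ : L%:R * expR (- (eta * J)) <= 1.
  rewrite -[L%:R]lnK ?posrE ?ltr0n // -expRD expR_le1.
  have : eta * (eta * M) <= eta * J by rewrite ler_pM2l; lra.
  lra.
(* As [Ical] dominates [J] times the number of non-free layers, a share [eta] of it pays a factor
   [expR (- (eta * J))] for each such layer. The sum over [f] then factorizes and is at most
   [expR 2]. *)
have step f : P f <= expR (- ((1 - 3 * eta) * M)) *
     \prod_l expR (- (if f l == None then 0 else eta * J)).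
  have := @class_bound eta eta (P f) f; move=> H.
  have {}H := H ltac:(lra) ltac:(lra) (HP f).
  apply: (le_trans H); rewrite -expR_sum -expRD ler_expR sumrN -opprD lerN2.
  have -> : \sum_l (if f l == None then 0 else eta * J) = #|~: free_layers f|%:R * (eta * J).
    rewrite mulr_natl -sumr_const [RHS]big_mkcond /=; apply: eq_bigr => l _.
    by rewrite !inE; case: (f l).
  have h1 := minIcal_le (free_layers f); have h2 := Ical_ge_card (free_layers f).
  rewrite -/M in h1; set I := Ical _ _ _ _ _ in h1 h2 *.
  have : (1 - 2 * eta) * I <= (1 - eta) * (1 - eta) * I by rewrite ler_wpM2r //; nra.
  have : (1 - 3 * eta) * M <= (1 - 3 * eta) * I by rewrite ler_wpM2l //; lra.
  have : eta * (#|~: free_layers f|%:R * J) <= eta * I by rewrite ler_pM2l; lra.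
  lra.
apply: (le_trans (ler_sum _ (fun f _ => step f))).
rewrite -mulr_sumr -(bigA_distr_bigA (fun l cl => expR (- (if cl == None then 0 else eta * J)))) /=.
under eq_bigr do rewrite sum_option_bool /= oppr0 expR0.
rewrite prodr_const card_ord.
have : (1 + (expR (- (eta * J)) + expR (- (eta * J)))) ^+ L <= expR 2.
  apply: (@le_trans _ _ (expR (expR (- (eta * J)) + expR (- (eta * J))) ^+ L)).
    by rewrite lerXn2r ?nnegrE ?expR_ge0 ?expR_ge1Dx // addr_ge0 // addr_ge0 // expR_ge0.
  rewrite -expRM_natl ler_expR mulrDr; lra.
move=> h; apply: (le_trans (ler_wpM2l (expR_ge0 _) h)).
rewrite -expRD ler_expR; lra.
Qed.

End LayerClasses.

(** * Errors of the likelihood maximization *)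

Section StageII.
Variables (R : realType) (n L : nat) (rho : R) (p q : 'I_L -> R).
Implicit Types (A : 'I_L -> 'I_n -> 'I_n -> bool) (zt : 'I_n -> bool).
Local Notation W := (flip_llr rho).

Definition node_llr A (i : 'I_n) zt (u : bool) (l : 'I_L) : R :=
  \sum_(j | j != i) (if zt j == u then 1 else -1) * edge_llr (p l) (q l) (A l i j).

(* A lower bound for the gain of the target
   label over its negation in one layer once s_l is maximized out: that gain is the
   log-likelihood ratio clipped to [-W, W]. *)
Definition clipped_llr A i zt u (flip : 'I_L -> bool) (l : 'I_L) : R :=
  if flip l then - W
  else if W <= node_llr A i zt u l then W else node_llr A i zt u l.

Lemma f_scoreE A i l sstar sl zt :
  f_score rho p q A i l sstar sl zt = W * (sl == sstar)%:R +
    \sum_(j | (j != i) && (zt j == sl)) edge_llr (p l) (q l) (A l i j).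
Proof. by []. Qed.

Lemma node_llr_split A i zt u l :
  node_llr A i zt u l =
    \sum_(j | (j != i) && (zt j == u)) edge_llr (p l) (q l) (A l i j) -
    \sum_(j | (j != i) && (zt j == ~~ u)) edge_llr (p l) (q l) (A l i j).
Proof.
rewrite /node_llr (bigID (fun j => zt j == u)) /= -sumrN; congr (_ + _).
  by apply: eq_bigr => j /andP[_ ->]; rewrite mul1r.
apply: eq_big => [j|j /andP[_ /negbTE->]]; last by rewrite mulN1r.
by congr (_ && _); case: (zt j) (u) => [] [].
Qed.

Lemma stageII_error A i zt u (sstar : bool) (s flip : 'I_L -> bool) : 0 <= W ->
  (forall t : 'I_L -> bool, \sum_l f_score rho p q A i l u (t l) zt <=
     \sum_l f_score rho p q A i l sstar (s l) zt) ->
  sstar = ~~ u -> \sum_l clipped_llr A i zt u flip l <= 0.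
Proof.
move=> W0 H su; rewrite {}su in H.
(* The competitor: global label [u] with the best layer labels for it. Its gain over any choice with
   global label [~~ u] is at least the clipped ratio in each layer. *)
pose t l := if - W <= node_llr A i zt u l then u else ~~ u.
have := H t; rewrite -subr_le0 -sumrB; apply: le_trans; apply: ler_sum => l _.
rewrite !f_scoreE /clipped_llr /t.
have D := node_llr_split A i zt u l; set x := node_llr A i zt u l in D *.
set g := (fun sl => \sum_(j | (j != i) && (zt j == sl)) edge_llr (p l) (q l) (A l i j)).
rewrite -!/(g _) in D *.
have Nu : (~~ u == u) = false by case: (u).
have uN : (u == ~~ u) = false by case: (u).
have [->|->] : s l = u \/ s l = ~~ u by case: (s l) (u) => [] []; auto.
- rewrite uN; case: (leP (- W) x) => h1; rewrite ?eqxx ?Nu;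
  case: (flip l) => //=; case: (leP W x) => h2; lra.
- rewrite eqxx; case: (leP (- W) x) => h1; rewrite ?eqxx ?Nu;
  case: (flip l) => //=; case: (leP W x) => h2; lra.
Qed.

End StageII.

(** * The model as an iterated Bernoulli expectation *)

Section Model.
Variables (R : realType) (n L : nat) (rho : R) (p q : 'I_L -> R) (zs : 'I_n -> bool).
Hypothesis rho01 : 0 < rho < 1 / 2.
Hypothesis pq01 : forall l, 0 < q l < p l /\ p l < 1.

(** The law of the edges given the flips; the value 0 off [i < j] matches the deterministic
    coordinates of the outcome space. *)
Definition edge_param (xi : {ffun 'I_L * 'I_n -> bool}) (y : 'I_L * 'I_n * 'I_n) : R :=
  if (y.1.2 < y.2)%N then
    if zs y.1.2 (+) xi y.1 == zs y.2 (+) xi (y.1.1, y.2) then p y.1.1 else q y.1.1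
  else 0.

Lemma edge_param01 xi y : 0 <= edge_param xi y <= 1.
Proof.
by have [? ?] := pq01 y.1.1; rewrite /edge_param; case: ifP; [case: ifP|]; lra.
Qed.

Definition imlsbm_mean (F : imlsbm_outcome L n -> R) : R :=
  bern_exp (fun=> rho) (fun xi => bern_exp (edge_param xi) (fun e => F (xi, e))).

Lemma imlsbm_probE E : imlsbm_prob rho p q zs E = imlsbm_mean (fun w => (E w)%:R).
Proof.
rewrite /imlsbm_prob /imlsbm_mean /bern_exp.
under [RHS]eq_bigr do rewrite mulr_sumr.
rewrite pair_big /=; apply: eq_bigr => -[xi e] _ /=; rewrite mulrA; congr (_ * _ * _).
apply: eq_bigr => -[[l a] b] _; rewrite /edge_param /layer_label /=.
by case: ifP.
Qed.

Lemma imlsbm_mean_le F G : (forall w, F w <= G w) -> imlsbm_mean F <= imlsbm_mean G.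
Proof.
move=> FG; apply: bern_exp_le => [_|xi]; first by have r01 := rho01; lra.
by apply: bern_exp_le => [y|e]; [exact: edge_param01 | exact: FG].
Qed.

Lemma imlsbm_mean_sum (I : finType) (P : pred I) (F : I -> imlsbm_outcome L n -> R) :
  imlsbm_mean (fun w => \sum_(i | P i) F i w) = \sum_(i | P i) imlsbm_mean (F i).
Proof.
rewrite /imlsbm_mean /bern_exp exchange_big /=; apply: eq_bigr => xi _.
rewrite -mulr_sumr exchange_big /=; congr (_ * _); apply: eq_bigr => e _.
by rewrite mulr_sumr.
Qed.

Lemma imlsbm_meanD F G :
  imlsbm_mean (fun w => F w + G w) = imlsbm_mean F + imlsbm_mean G.
Proof.
have := imlsbm_mean_sum xpredT (fun b : bool => if b then F else G).
rewrite big_bool /= => <-; congr imlsbm_mean; apply/boolp.funext => w.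
by rewrite big_bool.
Qed.

Lemma imlsbm_meanZ a F : imlsbm_mean (fun w => a * F w) = a * imlsbm_mean F.
Proof.
rewrite /imlsbm_mean -bern_expZ; congr bern_exp; apply/boolp.funext => xi.
by rewrite bern_expZ.
Qed.

Lemma imlsbm_mean_cst a : imlsbm_mean (fun=> a) = a.
Proof.
transitivity (bern_exp (fun _ : 'I_L * 'I_n => rho) (fun=> a)); last exact: bern_exp_cst.
by congr bern_exp; apply/boolp.funext => xi; rewrite bern_exp_cst.
Qed.

Definition incident (i : 'I_n) (x : 'I_L * 'I_n) : 'I_L * 'I_n * 'I_n :=
  if (i < x.2)%N then (x.1, i, x.2) else (x.1, x.2, i).

(** [incident i] is injective on the pairs with [j != i], and its image contains every triple at
    which [G] may differ from 1. *)
Lemma prod_incident (i : 'I_n) (G : 'I_L * 'I_n * 'I_n -> R) :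
  (forall l (a b : 'I_n), ~~ ((a < b)%N && ((a == i) || (b == i))) -> G (l, a, b) = 1) ->
  \prod_y G y = \prod_l \prod_(j | j != i) G (incident i (l, j)).
Proof.
move=> G1; rewrite (pair_big_dep xpredT (fun _ j => j != i) (fun l j => G (incident i (l, j)))) /=.
pose D := [set x : 'I_L * 'I_n | x.2 != i].
rewrite (eq_bigl (fun x => x \in D)); last by move=> x; rewrite inE.
rewrite (eq_bigr (fun x => G (incident i x))); last by case.
have inj : {in D &, injective (incident i)}.
  move=> [l j] [l' j']; rewrite !inE /incident /= => ji j'i.
  by case: ifP; case: ifP => _ _ [] *; subst => //; rewrite ?eqxx in ji j'i.
rewrite -(big_imset _ inj) /=.
rewrite [LHS](bigID (mem (incident i @: D))) /= [X in _ * X]big1 ?mulr1 // => -[[l a] b].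
move=> yN; apply: G1; apply: contra yN => /andP[ab /orP[/eqP ai|/eqP bi]].
- apply/imsetP; exists (l, b); first by rewrite inE /= -ai neq_ltn ab orbT.
  by rewrite /incident /= -ai ab.
- apply/imsetP; exists (l, a); first by rewrite inE /= -bi neq_ltn ab.
  by rewrite /incident /= -bi ltnNge ltnW.
Qed.

Lemma adj_of_incident (w : imlsbm_outcome L n) l i j :
  j != i -> adj_of w l i j = w.2 (incident i (l, j)).
Proof.
rewrite /adj_of /incident /= => ji; case: ltngtP => // /val_inj ij.
by rewrite ij eqxx in ji.
Qed.

End Model.

Lemma natr_card_sum (R : pzSemiRingType) (I : finType) (P : pred I) :
  #|[set j | P j]|%:R = \sum_j (P j)%:R :> R.
Proof.
rewrite -sum1_card natr_sum big_mkcond /=; apply: eq_bigr => j _.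
by rewrite inE; case: (P j).
Qed.

(** * Exponential moment of one layer at one node *)

Section LayerMgf.
Variables (R : realType) (n : nat) (p q tau C eta n0 m : R) (zs : 'I_n -> bool) (i : 'I_n).
Hypothesis qp : 0 < q < p.
Hypothesis p2 : p <= 1 / 2.
Hypothesis pC : p <= C * q.
Hypothesis tau01 : 0 < tau.
Hypothesis n0_le : forall b, n0 <= #|[set j | zs j == b]|%:R.
Hypothesis n0_ge : (1 - eta) * (n%:R / 2) + 2 * m * (1 + 4 * C / tau) <= n0 - 1.

(** A node [j] that is correctly initialized up to the sign [pi] and not flipped contributes exactly
    a Chernoff coefficient, at [t] or [1 - t] according to its cluster. The at most [2 * m] other
    nodes are paid for by the slack in [n0_ge]. *)
Lemma layer_mgf_bound (x zt : 'I_n -> bool) (pi : bool) (t : R) :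
  tau <= t <= 1 - tau ->
  #|[set j | (j != i) && (zt j (+) pi != zs j)]|%:R <= m ->
  #|[set j | x j]|%:R <= m ->
  \prod_(j | j != i) edge_mgf p q (zs i == zs j (+) x j)
      (- t * (if zt j == zs i (+) pi then 1 else -1)) <=
  expR (- ((1 - eta) * (n%:R / 2 * Iinfo p q t))).
Proof.
move=> tt mis flips.
have qp' := qp; have p2' := p2; have tau01' := tau01.
have p1 : p < 1 by lra.
have t01 : 0 <= t <= 1 by lra.
have chi_le := Iinfo_lower qp p1 pC tau01 tt.
have I0 := Iinfo_ge0 qp p1 t01.
set chi := 2 * (p - q) ^+ 2 / q in chi_le.
have chi0 : 0 <= chi by rewrite /chi divr_ge0 ?mulr_ge0 ?sqr_ge0 //; lra.
have IE := Iinfo_chern t qp p1; set I := Iinfo p q t in IE chi_le I0 *.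
set a := - ln (chern p q t) in IE; set a' := ln (chern p q (1 - t)) in IE.
have a0 : 0 <= a by rewrite /a oppr_ge0; exact: ln_chern_le0.
have a'0 : a' <= 0 by apply: ln_chern_le0 => //; lra.
have Ea : expR (- a) = chern p q t by rewrite opprK lnK ?posrE ?chern_gt0.
have Ea' : expR a' = chern p q (1 - t) by rewrite lnK ?posrE ?chern_gt0.
clearbody a a'.
(* [mj j] counts the defects of [j], and [v j] is the exponent of a node without defects. A defect
   gives up at most [v j <= I] and adds [chi]. *)
pose mj j : R := (zt j (+) pi != zs j)%:R + (x j)%:R.
pose v j : R := if zs j == zs i then a else - a'.
have fac j : edge_mgf p q (zs i == zs j (+) x j)
    (- t * (if zt j == zs i (+) pi then 1 else -1)) <= expR (- v j + mj j * (I + chi)).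
  have echi : expR chi <= expR (- v j + 1 * (I + chi)).
    by rewrite ler_expR /v; case: ifP => _; lra.
  have le1chi : 1 <= expR chi by rewrite -expR0 ler_expR.
  have cle : chern p q t <= expR chi by apply: le_trans le1chi; exact: chern_le1.
  have cle' : chern p q (1 - t) <= expR chi.
    by apply: le_trans le1chi; apply: chern_le1 => //; lra.
  have all_le b : edge_mgf p q b (- t * (if zt j == zs i (+) pi then 1 else -1)) <= expR chi.
    case: ifP => _; rewrite ?mulrN1 ?opprK ?mulr1; case: b.
    - by rewrite edge_mgf_match_pos.
    - by apply: edge_mgf_mismatch_pos; lra.
    - by apply: edge_mgf_mismatch_neg; lra.
    - by rewrite edge_mgf_match_neg.
  have [mj0|mj1] : mj j = 0 \/ 1 <= mj j.
    by rewrite /mj; case: (_ != _); case: (x j); [right|right|right|left]; rewrite /=; lra.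
  - have [zj xj] : zt j (+) pi = zs j /\ x j = false.
      move: mj0; rewrite /mj; case: eqP => [->|_]; case: (x j) => //= /eqP;
      by rewrite ?add0r ?addr0 -?natrD pnatr_eq0.
    rewrite mj0 mul0r addr0 xj addbF /v.
    have -> : (zt j == zs i (+) pi) = (zs j == zs i).
      by rewrite -zj; case: (zt j) (zs i) (pi) => [] [] [].
    rewrite [zs i == _]eq_sym; case: ifP => _; rewrite ?mulrN1 ?opprK ?mulr1.
      by rewrite edge_mgf_match_pos // Ea.
    by rewrite edge_mgf_match_neg // Ea'.
  - apply: (le_trans (all_le _)); apply: (le_trans echi).
    by rewrite ler_expR lerD2l ler_pM // ?addr_ge0.
apply: (@le_trans _ _ (\prod_(j | j != i) expR (- v j + mj j * (I + chi)))).
  apply: ler_prod => j _; rewrite fac andbT /edge_mgf.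
  by rewrite addr_ge0 ?mulr_ge0 ?expR_ge0 //; case: ifP; lra.
rewrite -expR_sum ler_expR big_split /= sumrN -mulr_suml.
have sum_mj : \sum_(j | j != i) mj j <= 2 * m.
  have -> : \sum_(j | j != i) mj j =
     #|[set j | (j != i) && (zt j (+) pi != zs j)]|%:R + \sum_(j | j != i) (x j)%:R.
    rewrite big_split /= natr_card_sum; congr (_ + _).
    by rewrite big_mkcond; apply: eq_bigr => j _; case: (j != i).
  have : \sum_(j | j != i) (x j)%:R <= \sum_j (x j)%:R :> R.
    by rewrite [leRHS](bigD1 i) //= lerDr.
  rewrite -natr_card_sum; lra.
(* Both clusters have at least [n0] nodes; the 1 accounts for the omitted node [i]. *)
have sum_v : (n0 - 1) * I <= \sum_(j | j != i) v j.
  have : \sum_j v j = #|[set j | zs j == zs i]|%:R * a +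
                      #|[set j | zs j == ~~ zs i]|%:R * - a'.
    rewrite !natr_card_sum !mulr_suml -big_split; apply: eq_bigr => j _ /=.
    rewrite /v; case: (zs j) (zs i) => [] [] /=; lra.
  rewrite (bigD1 i) //= {1}/v eqxx.
  have := ler_wpM2r a0 (n0_le (zs i)).
  have a'0' : 0 <= - a' by lra.
  have := ler_wpM2r a'0' (n0_le (~~ zs i)).
  rewrite IE; lra.
have Ic : 0 <= I + chi by lra.
have := ler_wpM2r Ic sum_mj.
have m0 : 0 <= m by apply: le_trans flips.
have h1 : 2 * m * (I + chi) <= 2 * m * (I + 4 * C / tau * I).
  by apply: ler_wpM2l; lra.
have := ler_wpM2r I0 n0_ge.
lra.
Qed.

End LayerMgf.

(** * Probability that a node is bad *)

Section NodeBound.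
Variables (R : realType) (n L : nat) (rho : R) (p q : 'I_L -> R) (zs : 'I_n -> bool).
Variables (i : 'I_n) (zt : ('I_L -> 'I_n -> 'I_n -> bool) -> 'I_n -> bool).
Variables (tau C eta n0 m : R).
Hypothesis rho01 : 0 < rho < 1 / 2.
Hypothesis pq01 : forall l, 0 < q l < p l /\ p l < 1.
Hypothesis p2 : forall l, p l <= 1 / 2.
Hypothesis pC : forall l, p l <= C * q l.
Hypothesis tau01 : 0 < tau.
Hypothesis n0_le : forall b, n0 <= #|[set j | zs j == b]|%:R.
Hypothesis n0_ge : (1 - eta) * (n%:R / 2) + 2 * m * (1 + 4 * C / tau) <= n0 - 1.
Hypothesis zt_local : forall A A' : 'I_L -> 'I_n -> 'I_n -> bool,
  (forall l a b, a != i -> b != i -> A l a b = A' l a b) -> zt A = zt A'.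

Local Notation W := (flip_llr rho).

Definition align_sign (z : 'I_n -> bool) : bool :=
  (#|[set j | (j != i) && (~~ z j != zs j)]| < #|[set j | (j != i) && (z j != zs j)]|)%N.

Lemma align_signE (z : 'I_n -> bool) :
  #|[set j | (j != i) && (z j (+) align_sign z != zs j)]| = init_err z zs i.
Proof.
rewrite /init_err /align_sign; set a := #|[set j | (j != i) && (z j != zs j)]|.
set b := #|[set j | (j != i) && (~~ z j != zs j)]|.
case: (ltnP b a) => _.
  by apply: eq_card => j; rewrite !inE addbT.
by apply: eq_card => j; rewrite !inE addbF.
Qed.

(** The true global label of [i], expressed in the sign convention of its own initialization. *)
Definition node_target (w : imlsbm_outcome L n) : bool :=
  zs i (+) align_sign (zt (adj_of w)).

Definition node_bad (w : imlsbm_outcome L n) : bool :=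
  [&& (init_err (zt (adj_of w)) zs i)%:R <= m,
      [forall l, #|[set j | w.1 (l, j)]|%:R <= m] &
      \sum_l clipped_llr rho p q (adj_of w) i (zt (adj_of w)) (node_target w)
        (fun l => w.1 (l, i)) l <= 0].

Definition node_class (w : imlsbm_outcome L n) : {ffun 'I_L -> option bool} :=
  [ffun l => if w.1 (l, i) then Some true
     else if W <= node_llr p q (adj_of w) i (zt (adj_of w)) (node_target w) l
     then Some false else None].

(** Only the edges at [i] are resampled, so by [zt_local] the initialization is frozen. The flips
    are fixed here, so their price [W] is taken out of the cost. *)
Lemma node_class_edges (f : {ffun 'I_L -> option bool}) (t : R) (xi : {ffun 'I_L * 'I_n -> bool}) :
  tau <= t <= 1 - tau ->
  (forall l, xi (l, i) = (f l == Some true)) ->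
  bern_exp (edge_param p q zs xi)
    (fun e => (node_bad (xi, e) && (node_class (xi, e) == f))%:R) <=
  expR (- \sum_l (class_cost n rho p q eta t l (f l) - W * (f l == Some true)%:R)).
Proof.
move=> tt xif; have t0 : 0 <= t by have := tau01; lra.
pose M (y : 'I_L * 'I_n * 'I_n) := (y.1.2 == i) || (y.2 == i).
(* The part of the exponential tilt that comes from layers clipped to [W] or [- W]. *)
pose K : R := expR (- (t * \sum_l (W * ((f l == Some false)%:R - (f l == Some true)%:R)))).
apply: (@bern_exp_cond_le _ _ _ M).
  by move=> y; exact: edge_param01.
move=> e; set A := adj_of (xi, e).
have ztE e' : zt (adj_of (xi, splice M e e')) = zt A.
  apply: zt_local => l a b ai bi; rewrite /A /adj_of !ffunE /M /=.
  by rewrite (negbTE ai) (negbTE bi).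
have [good|bad] := boolP (((init_err (zt A) zs i)%:R <= m) &&
                          [forall l, #|[set j | xi (l, j)]|%:R <= m]); last first.
  exists 0, (fun _ _ => 0); split; last by rewrite mul0r expR_ge0.
  by move=> e'; rewrite mul0r /node_bad ztE andbA /= (negbTE bad).
pose z := zt A; pose u := zs i (+) align_sign z.
pose sg j : R := if z j == u then 1 else -1.
pose g (y : 'I_L * 'I_n * 'I_n) (b : bool) : R :=
  if (f y.1.1 == None) && (y.1.2 < y.2)%N then
    if y.1.2 == i then expR (- t * sg y.2 * edge_llr (p y.1.1) (q y.1.1) b)
    else if y.2 == i then expR (- t * sg y.1.2 * edge_llr (p y.1.1) (q y.1.1) b) else 1
  else 1.
have gE l j b : j != i -> g (incident i (l, j)) b =
    if f l == None then expR (- t * sg j * edge_llr (p l) (q l) b) else 1.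
  rewrite /incident /= => ji; have [h|h|/val_inj h] := ltngtP i j.
  - by rewrite /g /= h andbT eqxx.
  - by rewrite /g /= h andbT (negbTE ji) eqxx.
  - by rewrite h eqxx in ji.
have g1 l (a b : 'I_n) c : ~~ ((a < b)%N && ((a == i) || (b == i))) -> g (l, a, b) c = 1.
  by rewrite /g /=; case: (a < b)%N; case: (a == i); case: (b == i); rewrite ?andbF // if_same.
exists K, g; split.
  move=> e'; set w := splice _ e e'.
  rewrite (@prod_incident _ _ _ i (fun y => g y (e' y))); last by move=> l a b /g1 ->.
  have [/andP[bad /eqP cls]|_] := boolP (node_bad _ && _); last first.
    rewrite mulr_ge0 ?expR_ge0 //; apply: prodr_ge0 => l _; apply: prodr_ge0 => j ji.
    by rewrite gE //; case: ifP; rewrite ?expR_ge0.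
  have {bad} S0 : \sum_l clipped_llr rho p q (adj_of (xi, w)) i z u (fun l => xi (l, i)) l <= 0.
    by move: bad; rewrite /node_bad /node_target !ztE => /and3P[].
  have -> : \prod_l \prod_(j | j != i) g (incident i (l, j)) (e' (incident i (l, j))) =
     expR (- (t * \sum_l (if f l == None
                       then node_llr p q (adj_of (xi, w)) i z u l else 0))).
    rewrite mulr_sumr -sumrN expR_sum; apply: eq_bigr => l _.
    transitivity (\prod_(j | j != i) if f l == None then
        expR (- t * sg j * edge_llr (p l) (q l) (e' (incident i (l, j)))) else 1).
      by apply: eq_bigr => j ji; rewrite gE.
    case: ifP => _; last by rewrite big1_eq mulr0 oppr0 expR0.
    rewrite -expR_sum -mulNr /node_llr mulr_sumr; congr expR; apply: eq_bigr => j ji.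
    rewrite adj_of_incident // /w /= ffunE /M mulrA.
    by rewrite /incident; case: ifP => _ /=; rewrite eqxx ?orbT.
  rewrite -expRD -opprD -mulrDr -big_split /=.
  (* Chernoff: on the event the tilted sum is at most the clipped sum, hence at most 0, so the
     majorant is at least 1. *)
  apply: (@le_trans _ _ (expR 0)); first by rewrite expR0.
  rewrite ler_expR oppr_ge0.
  apply: mulr_ge0_le0 => //; apply: le_trans S0; apply: ler_sum => l _.
  have := congr1 (fun F : {ffun _} => F l) cls; rewrite ffunE /node_target ztE -/z -/u.
  rewrite /clipped_llr /=; case: (xi (l, i)) => [<-|] /=; first lra.
  by case: ifP => _ <- /=; lra.
rewrite (@prod_incident _ _ _ i (fun y =>
  edge_param p q zs xi y * g y true + (1 - edge_param p q zs xi y) * g y false)); last first.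
  by move=> l a b h; rewrite !g1 //; ring.
(* In a free layer [i] is not flipped, so the type of an edge depends on the flip of [j] alone. *)
have parE l j : j != i -> f l = None -> edge_param p q zs xi (incident i (l, j)) =
    if zs i == zs j (+) xi (l, j) then p l else q l.
  move=> ji fl; have xl : xi (l, i) = false by rewrite xif fl.
  rewrite /incident /=; have [h|h|/val_inj h] := ltngtP i j.
  - by rewrite /edge_param /= h xl addbF.
  - by rewrite /edge_param /= h xl addbF eq_sym.
  - by rewrite h eqxx in ji.
have layer l : \prod_(j | j != i) (edge_param p q zs xi (incident i (l, j)) * g (incident i (l, j)) true +
    (1 - edge_param p q zs xi (incident i (l, j))) * g (incident i (l, j)) false) <=
    expR (- (if f l == None then (1 - eta) * (n%:R / 2 * Iinfo (p l) (q l) t) else 0)).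
  case: eqP => fl; last first.
    rewrite oppr0 expR0 big1 // => j ji; rewrite !gE //; case: eqP => // _; ring.
  have [qp p1] := pq01 l; move: good => /andP[mis /forallP flips].
  have := @layer_mgf_bound R n (p l) (q l) tau C eta n0 m zs i qp (p2 l) (pC l) tau01 n0_le n0_ge
    (fun j => xi (l, j)) z (align_sign z) t tt.
  rewrite align_signE => H; apply: le_trans (H mis (flips l)); apply: ler_prod => j ji.
  rewrite parE // !gE // fl eqxx /edge_mgf lexx andbT.
  by rewrite addr_ge0 ?mulr_ge0 ?expR_ge0 //; case: ifP; lra.
apply: (@le_trans _ _ (K * \prod_l
    expR (- (if f l == None then (1 - eta) * (n%:R / 2 * Iinfo (p l) (q l) t) else 0)))).
  apply: ler_wpM2l; first exact: expR_ge0.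
  apply: ler_prod => l _; rewrite layer andbT; apply: prodr_ge0 => j ji.
  have r01 := edge_param01 zs pq01 xi (incident i (l, j)).
  rewrite !gE //; case: ifP => _; rewrite addr_ge0 ?mulr_ge0 ?expR_ge0 //; lra.
rewrite -expR_sum -expRD ler_expR sumrN -opprD lerN2 mulr_sumr -big_split /=.
apply: ler_sum => l _; rewrite /class_cost; case: (f l) => [[]|] /=; lra.
Qed.

(** Averaging over the flips restores the missing [W]: each class [Some true] forces a flip of [i],
    of probability [rho <= expR (- W)]. *)
Lemma node_class_prob (f : {ffun 'I_L -> option bool}) (t : R) :
  tau <= t <= 1 - tau ->
  imlsbm_mean rho p q zs (fun w => (node_bad w && (node_class w == f))%:R) <=
  expR (- \sum_l class_cost n rho p q eta t l (f l)).
Proof.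
move=> tt; pose ok (y : 'I_L * 'I_n) (b : bool) : R :=
  ((y.2 == i) && (f y.1 == Some true) ==> b)%:R.
set Kc := expR (- \sum_l (class_cost n rho p q eta t l (f l) - W * (f l == Some true)%:R)).
apply: (@le_trans _ _ (bern_exp (fun=> rho) (fun xi => Kc * \prod_y ok y (xi y)))).
  apply: bern_exp_le => [y|xi]; first by have := rho01; lra.
  have [/forallP xif|] := boolP [forall l, xi (l, i) == (f l == Some true)].
    rewrite big1 ?mulr1; first by apply: node_class_edges => // l; apply/eqP.
    move=> [l j] _; rewrite /ok /=; case: eqP => //= ->; rewrite (eqP (xif l)).
    by case: (f l == _).
  move=> /forallPn[l xl]; apply: (@le_trans _ _ 0); last first.
    by rewrite mulr_ge0 ?expR_ge0 //; apply: prodr_ge0.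
  rewrite -[leRHS](bern_exp_cst (edge_param p q zs xi)).
  apply: bern_exp_le => [y|e]; first exact: edge_param01.
  case: andP => // -[_ /eqP cls]; exfalso; move/negP: xl; apply.
  rewrite -cls ffunE /=; case: (xi (l, i)) => //=; by case: ifP.
rewrite bern_expZ bern_exp_prod.
have -> : \prod_(y : 'I_L * 'I_n) (rho * ok y true + (1 - rho) * ok y false) =
    \prod_l (if f l == Some true then rho else 1).
  rewrite -(pair_bigA _ (fun l j => rho * ok (l, j) true + (1 - rho) * ok (l, j) false)) /=.
  apply: eq_bigr => l _; rewrite (bigD1 i) //= big1 ?mulr1.
    by rewrite /ok /= eqxx /=; case: (f l == Some true) => /=; ring.
  by move=> j ji; rewrite /ok /= (negbTE ji) /=; ring.
apply: (@le_trans _ _ (Kc * \prod_l expR (- (W * (f l == Some true)%:R)))).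
  apply: ler_wpM2l; first exact: expR_ge0.
  have r0 := rho01; apply: ler_prod => l _; case: (f l == Some true) => /=.
    by rewrite mulr1 le_expRN_flip_llr // andbT; lra.
  by rewrite mulr0 oppr0 expR0 lexx ler01.
rewrite -expR_sum /Kc -expRD ler_expR sumrN -opprD lerN2 -big_split /=.
by apply: ler_sum => l _; lra.
Qed.

Lemma node_bad_prob (c : R) :
  let M := minIcal n rho p q in
  tau = eta / 2 -> 0 < eta <= 1 / 4 -> 0 < c < 1 ->
  ln 3 <= eta * ((1 - c) * Jrho rho) ->
  2 * (L%:R * expR (- (c * Jrho rho))) <= eta * M ->
  (0 < L)%N -> ln L%:R <= eta ^+ 2 * M -> 2 <= eta * M ->
  imlsbm_mean rho p q zs (fun w => (node_bad w)%:R) <= expR (- ((1 - 4 * eta) * M)).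
Proof.
move=> M tauE eta01 c01 h1 h2 h3 h4 h5.
have := @class_sum_bound R n L rho p q rho01 pq01 eta c
  (fun f => imlsbm_mean rho p q zs (fun w => (node_bad w && (node_class w == f))%:R))
  eta01 c01 h1 h2 h3 h4 h5.
rewrite -tauE => H; apply: le_trans (H _); last by move=> f t; exact: node_class_prob.
rewrite -imlsbm_mean_sum; apply: imlsbm_mean_le => // w.
case: (node_bad w) => //=; last by rewrite big1.
rewrite (bigD1 (node_class w)) //= eqxx lerDl sumr_ge0 //.
Qed.

End NodeBound.

(** * Alignment, and locality of the leave-one-out initialization *)

Lemma stageIII_align n (zs z1 zi : 'I_n -> bool) (pi1 pii : bool) (i : 'I_n) (s : bool)
    (e1 ei : nat) :
  (#|[set j | z1 j (+) pi1 != zs j]| <= e1)%N ->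
  (#|[set j | zi j (+) pii != zs j]| <= ei)%N ->
  (forall b, 2 * (e1 + ei) < #|[set j | zs j == b]|)%N ->
  (forall s', #|[set j | (z1 j == s') && (zi j == zi i)]|
           <= #|[set j | (z1 j == s) && (zi j == zi i)]|)%N ->
  s (+) pi1 = zi i (+) pii.
Proof.
move=> h1 hi hN hs; apply/eqP/negPn/negP => neq.
set E1 := [set j | z1 j (+) pi1 != zs j] in h1; set Ei := [set j | zi j (+) pii != zs j] in hi.
have hE : (#|E1 :|: Ei| <= e1 + ei)%N.
  by apply: leq_trans (leq_add h1 hi); rewrite cardsU leq_subr.
(* For the wrong sign the counted nodes are all errors of one of the two vectors, while the opposite
   sign counts a whole true cluster apart from such errors. A cluster of more than twice the error
   count contradicts maximality. *)
have sub1 : [set j | (z1 j == s) && (zi j == zi i)] \subset E1 :|: Ei.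
  apply/fintype.subsetP => j; rewrite !inE => /andP[/eqP -> /eqP ->].
  by move: neq; case: (s (+) pi1) (zi i (+) pii) (zs j) => [] [] [].
have sub2 : [set j | zs j == zi i (+) pii] \subset
    [set j | (z1 j == ~~ s) && (zi j == zi i)] :|: (E1 :|: Ei).
  apply/fintype.subsetP => j; rewrite !inE => /eqP ->.
  by move: neq; case: (s) (pi1) (pii) (zi i) (z1 j) (zi j) => [] [] [] [] [] [].
have := hN (zi i (+) pii); rewrite ltnNge => /negP; apply.
apply: (leq_trans (subset_leq_card sub2)).
apply: (@leq_trans (#|[set j | (z1 j == ~~ s) && (zi j == zi i)]| + #|E1 :|: Ei|)).
  by rewrite cardsU leq_subr.
rewrite mul2n -addnn; apply: leq_add => //; apply: (leq_trans (hs _)).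
by apply: leq_trans hE; exact: subset_leq_card.
Qed.

Lemma ztilde_local (L : nat -> nat)
    (Init : forall n, ('I_(L n) -> 'I_n.-1 -> 'I_n.-1 -> bool) -> 'I_n.-1 -> bool)
    n (i : 'I_n) (A A' : 'I_(L n) -> 'I_n -> 'I_n -> bool) :
  (forall l a b, a != i -> b != i -> A l a b = A' l a b) ->
  ztilde Init A i = ztilde Init A' i.
Proof.
move=> AA'; rewrite /ztilde; congr (Defs.reindex i (Init n _)).
apply/boolp.funext => l; apply/boolp.funext => a; apply/boolp.funext => b.
by rewrite /delete_node AA' // eq_sym neq_lift.
Qed.

(** * From bad nodes to the loss, for fixed n *)

Section FiniteBound.
Variables (R : realType) (L : nat -> nat).
Variable Init : forall n, ('I_(L n) -> 'I_n.-1 -> 'I_n.-1 -> bool) -> 'I_n.-1 -> bool.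
Variables (n : nat) (rho : R) (p q : 'I_(L n) -> R) (zs : 'I_n -> bool) (n0 m : R).
Hypothesis rho01 : 0 < rho < 1 / 2.
Hypothesis pq01 : forall l, 0 < q l < p l /\ p l < 1.
Hypothesis n_gt0 : (0 < n)%N.
Hypothesis n0_le : forall b, n0 <= #|[set j | zs j == b]|%:R.
Hypothesis mn0 : 4 * m + 4 < n0.

Local Notation bad i := (node_bad rho p q zs i (fun A => ztilde Init A i) m).

Lemma loss_le_bad (w : imlsbm_outcome (L n) n) (zhat : 'I_n -> bool) :
  alg3_global_output Init rho p q (adj_of w) zhat ->
  (forall i, (init_err (ztilde Init (adj_of w) i) zs i)%:R <= m) ->
  (forall l, #|[set j | w.1 (l, j)]|%:R <= m) ->
  loss R zhat zs <= (\sum_i (bad i w)%:R) / n%:R.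
Proof.
move=> [sb [opt]] /=; set A := adj_of w => al init flips.
pose i1 : 'I_n := Ordinal n_gt0.
have [al1 ali] := al i1 erefl.
pose pi i := align_sign zs i (ztilde Init A i).
pose zbar i j := if j == i then (sb i).1 else ztilde Init A i j.
(* The successor accounts for the entry at [i], which comes from Stage II and is not controlled by
   the initialization. *)
have zbar_err i : (#|[set j | zbar i j (+) pi i != zs j]| <=
    (init_err (ztilde Init A i) zs i).+1)%N.
  rewrite -align_signE -/(pi i) -add1n.
  apply: (@leq_trans #|i |: [set j | (j != i) && (ztilde Init A i j (+) pi i != zs j)]|).
    apply: subset_leq_card; apply/fintype.subsetP => j; rewrite !inE /zbar.
    by case: (j == i).
  by rewrite cardsU1 leq_add2r leq_b1.
have sbE i : zhat i (+) pi i1 = (sb i).1 (+) pi i.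
  have zii : zbar i i = (sb i).1 by rewrite /zbar eqxx.
  have [->|ii1] := eqVneq i i1; first by rewrite al1 eqxx.
  have i0 : val i <> 0%N by move=> h; move/eqP: ii1; apply; exact: val_inj.
  (* Both error counts are at most [m + 1], whence the threshold [4 * m + 4]. *)
  rewrite -zii; apply: (stageIII_align (zbar_err i1) (zbar_err i)); last exact: (ali i i0).
  move=> b; rewrite -(@ltr_nat R); apply: lt_le_trans (n0_le b); rewrite natrM natrD -!(natr1 (init_err _ _ _)).
  have := mn0; have := init i1; have := init i; lra.
have err_bad i : zhat i (+) pi i1 != zs i -> bad i w.
  rewrite sbE => e; apply/and3P; split; [exact: init|apply/forallP => l; exact: flips|].
  have W0 : 0 <= flip_llr rho.
    by have := flip_llr_ge rho01; have := Jrho_gt0 rho01; lra.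
  apply: (@stageII_error _ _ _ rho p q A i (ztilde Init A i) _ (sb i).1 (sb i).2).
  - exact: W0.
  - by move=> t; exact: (opt i _ t).
  - rewrite /node_target -/(pi i).
    by move: e; case: ((sb i).1) (pi i) (zs i) => [] [] [].
rewrite /loss ler_pM2r ?invr_gt0 ?ltr0n // -natr_sum ler_nat.
apply: (@leq_trans #|[set i | zhat i (+) pi i1 != zs i]|).
  rewrite geq_min /hamming; case: (pi i1); apply/orP; [right|left];
  by apply: subset_leq_card; apply/fintype.subsetP => j; rewrite !inE /= ?addbT ?addbF.
rewrite -sum1_card [leqRHS](bigID [pred i | zhat i (+) pi i1 != zs i]) /=.
apply: (leq_trans _ (leq_addr _ _)).
rewrite (eq_bigl (fun i => zhat i (+) pi i1 != zs i)); last by move=> i; rewrite inE.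
by apply: leq_sum => i /err_bad ->.
Qed.

(** Chernoff's bound with parameter 1: each node contributes at most [1 + rho * expR 1]. *)
Lemma flips_tail (l : 'I_(L n)) (e0 : R) : m = n%:R * e0 -> rho * expR 1 <= e0 / 2 ->
  imlsbm_mean rho p q zs (fun w => (m < #|[set j | w.1 (l, j)]|%:R)%R%:R) <=
  expR (- (n%:R * (e0 / 2))).
Proof.
move=> mE rhoe; have r01 := rho01; rewrite /imlsbm_mean.
pose g (y : 'I_(L n) * 'I_n) (b : bool) : R := if (y.1 == l) && b then expR 1 else 1.
apply: (@le_trans _ _ (bern_exp (fun=> rho) (fun xi => expR (- m) * \prod_y g y (xi y)))).
  apply: bern_exp_le => [y|xi]; first lra.
  rewrite /= bern_exp_cst.
  have -> : \prod_y g y (xi y) = expR #|[set j | xi (l, j)]|%:R.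
    transitivity (\prod_l' \prod_j g (l', j) (xi (l', j))).
      by rewrite pair_bigA; apply: eq_bigr => -[].
    rewrite (bigD1 l) //=.
    rewrite [X in _ * X]big1 ?mulr1; last first.
      by move=> l' l'l; rewrite big1 // => j _; rewrite /g /= (negbTE l'l).
    rewrite natr_card_sum expR_sum; apply: eq_bigr => j _.
    by rewrite /g /= eqxx; case: (xi (l, j)); rewrite /= ?expR0.
  rewrite -expRD; case: ltP => h; last exact: expR_ge0.
  by apply: (@le_trans _ _ (expR 0)); [rewrite expR0 | rewrite ler_expR; lra].
rewrite bern_expZ bern_exp_prod -(pair_bigA _ (fun l' j => rho * g (l', j) true + (1 - rho) * g (l', j) false)) /=.
rewrite (bigD1 l) //= [X in _ * (_ * X) <= _]big1 ?mulr1; last first.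
  by move=> l' l'l; rewrite big1 // => j _; rewrite /g /= (negbTE l'l) /=; ring.
apply: (@le_trans _ _ (expR (- m) * expR (n%:R * (rho * expR 1)))).
  apply: ler_wpM2l; first exact: expR_ge0.
  have -> : n%:R * (rho * expR 1) = \sum_(j < n) (rho * expR 1).
    by rewrite sumr_const card_ord mulr_natl.
  have e0' := expR_gt0 (1 : R).
  rewrite expR_sum; apply: ler_prod => j _; rewrite /g /= eqxx /=; apply/andP; split.
    by rewrite addr_ge0 ?mulr_ge0 //; lra.
  by apply: le_trans (expR_ge1Dx _); lra.
rewrite -expRD ler_expR mE.
have n0' : 0 <= n%:R :> R by [].
have := ler_wpM2l n0' rhoe; lra.
Qed.

Lemma loss_prob_ge (est : ('I_(L n) -> 'I_n -> 'I_n -> bool) -> 'I_n -> bool)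
    (eta M a1 a2 : R) :
  (forall A, alg3_global_output Init rho p q A (est A)) ->
  (forall i, imlsbm_mean rho p q zs (fun w => (bad i w)%:R) <= expR (- ((1 - 4 * eta) * M))) ->
  (forall i, imlsbm_prob rho p q zs
     (fun w => m < (init_err (ztilde Init (adj_of w) i) zs i)%:R) <= a1) ->
  (forall l, imlsbm_mean rho p q zs (fun w => (m < #|[set j | w.1 (l, j)]|%:R)%R%:R) <= a2) ->
  1 - n%:R * a1 - (L n)%:R * a2 - expR (- (eta * M)) <=
  imlsbm_prob rho p q zs (fun w => loss R (est (adj_of w)) zs <= expR (- ((1 - 5 * eta) * M))).
Proof.
move=> Hest Hbad Hinit Hflip; rewrite imlsbm_probE.
set thr := expR (- ((1 - 5 * eta) * M)); set F := fun w => _.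
have thr0 : 0 < thr by exact: expR_gt0.
pose B1 w : R := \sum_i (m < (init_err (ztilde Init (adj_of w) i) zs i)%:R)%R%:R.
pose B2 (w : imlsbm_outcome (L n) n) : R := \sum_l (m < #|[set j | w.1 (l, j)]|%:R)%R%:R.
pose B3 w : R := \sum_i (bad i w)%:R.
(* A union bound and Markov's inequality in pointwise form; taking means gives the claim. *)
have pw w : 1 <= F w + (B1 w + (B2 w + (thr * n%:R)^-1 * B3 w)).
  have F0 : 0 <= F w by rewrite /F.
  have B10 : 0 <= B1 w by apply: sumr_ge0.
  have B20 : 0 <= B2 w by apply: sumr_ge0.
  have B30 : 0 <= (thr * n%:R)^-1 * B3 w.
    by apply: mulr_ge0; [rewrite invr_ge0 mulr_ge0 // ltW | apply: sumr_ge0].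
  have [/forallP gi|/forallPn[i]] := boolP [forall i,
      (init_err (ztilde Init (adj_of w) i) zs i)%:R <= m]; last first.
    rewrite -ltNge => gi; have : 1 <= B1 w; last lra.
    by rewrite /B1 (bigD1 i) //= gi lerDl sumr_ge0.
  have [/forallP gl|/forallPn[l]] := boolP [forall l, #|[set j | w.1 (l, j)]|%:R <= m]; last first.
    rewrite -ltNge => gl; have : 1 <= B2 w; last lra.
    by rewrite /B2 (bigD1 l) //= gl lerDl sumr_ge0.
  have h2 := loss_le_bad (Hest (adj_of w)) gi gl; rewrite -/(B3 w) in h2.
  have [h1|h1] := leP (loss R (est (adj_of w)) zs) thr.
    have : F w = 1 by rewrite /F h1.
    by move: (F w) (B1 w) (B2 w) (_ * B3 w) F0 B10 B20 B30 => *; lra.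
  have : 1 <= (thr * n%:R)^-1 * B3 w.
    rewrite invfM -mulrA ler_pdivlMl // mulr1 mulrC.
    by apply: le_trans h2; exact: ltW.
  by move: (F w) (B1 w) (B2 w) (_ * B3 w) F0 B10 B20 B30 => *; lra.
have := imlsbm_mean_le zs rho01 pq01 pw.
rewrite imlsbm_mean_cst !imlsbm_meanD // imlsbm_meanZ /B1 /B2 /B3 !imlsbm_mean_sum.
set P1 := \sum_i imlsbm_mean _ _ _ _ _; set P2 := \sum_l imlsbm_mean _ _ _ _ _.
set P3 := \sum_i imlsbm_mean _ _ _ _ _.
have cst k (c : R) : k%:R * c = \sum_(i < k) c by rewrite sumr_const card_ord mulr_natl.
have h1 : P1 <= n%:R * a1.
  rewrite cst; apply: ler_sum => i _.
  by apply: le_trans (Hinit i); rewrite imlsbm_probE.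
have h2 : P2 <= (L n)%:R * a2.
  by rewrite cst; apply: ler_sum => l _; exact: Hflip.
have h3 : P3 <= n%:R * expR (- ((1 - 4 * eta) * M)).
  by rewrite cst; apply: ler_sum => i _; exact: Hbad.
have h4 : (thr * n%:R)^-1 * P3 <= expR (- (eta * M)).
  rewrite ler_pdivrMl ?mulr_gt0 ?ltr0n //; apply: (le_trans h3).
  by rewrite mulrAC -expRD mulrC ler_wpM2r // ler_expR; lra.
lra.
Qed.

End FiniteBound.

Lemma in_Pn_card (R : realType) n (beta : R) (zs : 'I_n -> bool) (b : bool) :
  in_Pn beta zs -> n%:R / (2 * beta) <= #|[set j | zs j == b]|%:R.
Proof.
case=> /andP[h1 _] /andP[h2 _].
case: b; [apply: (le_trans h1)|apply: (le_trans h2)]; rewrite ler_nat;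
apply: subset_leq_card; apply/fintype.subsetP => j; rewrite !inE.
  by move=> ->.
by move=> /negbTE ->.
Qed.

Local Open Scope classical_set_scope.
Local Open Scope ring_scope.

(** * Limits and the choice of constants *)

Section Asymptotics.
Variable R : realType.

(* Choosing d n slightly above inf {eta > 0 | 1 - eta <= Q n eta} turns a family of
   limits indexed by eta into a single one along a vanishing sequence. *)
Lemma diagonal_cvg1 (Q : nat -> R -> R) :
  (forall n x, 0 <= Q n x <= 1) ->
  (\forall n \near \oo, forall x y, x <= y -> Q n x <= Q n y) ->
  (forall eta, 0 < eta < 1 -> \forall n \near \oo, 1 - eta <= Q n eta) ->
  exists2 d : nat -> R, d @ \oo --> 0 & (fun n => Q n (d n)) @ \oo --> (1 : R).
Proof.
move=> Q01 Qmono Qeta.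
pose A n := [set eta : R | 0 < eta /\ 1 - eta <= Q n eta].
have A0 n : A n !=set0.
  by exists 1; split=> //; rewrite subrr; case/andP: (Q01 n 1).
have Alb n : has_inf (A n).
  by split; [exact: A0 | exists 0 => x [/ltW]].
have inf0 n : 0 <= inf (A n) by apply: lb_le_inf; [exact: A0 | move=> x [/ltW]].
pose d n := inf (A n) + n.+1%:R^-1.
have n0 n : 0 < n.+1%:R^-1 :> R by rewrite invr_gt0.
have d0 : d @ \oo --> 0.
  apply/cvgrPdist_le => e e0.
  (* The cap at 1/2 keeps [e'] in the range where [Qeta] applies. *)
  pose e' := Num.min (e / 2) (1 / 2).
  have e'01 : 0 < e' < 1 by rewrite lt_min gt_min; lra.
  near=> n.
  rewrite sub0r normrN ger0_norm; last by rewrite addr_ge0 // ltW.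
  have h : 1 - e' <= Q n e' by near: n; exact: Qeta.
  have : inf (A n) <= e' by apply: ge_inf; [case: (Alb n) | split=> //; by have := e'01; lra].
  have : e' <= e / 2 by rewrite ge_min lexx.
  have : n.+1%:R^-1 <= e / 2.
    rewrite -[e / 2]invrK lef_pV2 ?posrE ?invr_gt0 ?divr_gt0 //.
    apply: (@le_trans _ _ n%:R); last by rewrite ler_nat.
    by near: n; exact: nbhs_infty_ger.
  by move=> h1 h2 h3; rewrite (splitr e) /d lerD // (le_trans h3).
exists d => //; apply: (@squeeze_cvgr _ _ _ _ (fun n => 1 - d n) (fun=> 1)).
- near=> n; apply/andP; split; last by case/andP: (Q01 n (d n)).
  have [x [x0 xQ] xd] := inf_adherent (n0 n) (Alb n).
  have : Q n x <= Q n (d n).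
    have mono : forall x y, x <= y -> Q n x <= Q n y by near: n; exact: Qmono.
    by apply: mono; exact: ltW.
  by have xd' : x < d n := xd; lra.
- by rewrite -[X in _ --> X]subr0; apply: cvgB => //; exact: cvg_cst.
- exact: cvg_cst.
Unshelve. all: end_near. Qed.

Lemma near_ln_natr (K : R) : \forall n \near \oo, K <= ln n%:R.
Proof.
near=> n; have h : expR K <= n%:R by near: n; exact: nbhs_infty_ger.
by rewrite -ler_expR lnK // posrE (lt_le_trans _ h) // expR_gt0.
Unshelve. all: end_near. Qed.

Lemma near_powRN_small (C e k : R) : 0 < C -> 0 < e -> 0 < k ->
  \forall n \near \oo, n%:R * (C * n%:R `^ (- (1 + e))) <= k.
Proof.
move=> C0 e0 k0; near=> n.
have n0 : (0 < n)%N by near: n; exact: nbhs_infty_gt.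
have h : - ln (k / C) / e <= ln n%:R by near: n; exact: near_ln_natr.
have En : n%:R = expR (ln n%:R) :> R by rewrite lnK ?posrE ?ltr0n.
rewrite /powR pnatr_eq0 gtn_eqF // {1}En mulrCA -expRD mulrC -ler_pdivlMr //.
rewrite -[leRHS]lnK ?posrE ?divr_gt0 // ler_expR.
by move: h; rewrite ler_pdivrMr //; lra.
Unshelve. all: end_near. Qed.

Lemma near_powR_expRN_small (c b k : R) : 0 < c -> 0 < b -> 0 < k ->
  \forall n \near \oo, n%:R `^ c * expR (- (n%:R * b)) <= k.
Proof.
move=> c0 b0 k0; near=> n.
have n0 : (0 < n)%N by near: n; exact: nbhs_infty_gt.
(* Chosen so that [ln (s * n) < s * n] bounds [c * ln n] by half of the exponent [n * b] plus a
   constant. *)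
pose s := b / (2 * c); have s0 : 0 < s by rewrite divr_gt0 ?mulr_gt0.
have h : (- ln k - c * ln s) / (b / 2) <= n%:R by near: n; exact: nbhs_infty_ger.
rewrite /powR pnatr_eq0 gtn_eqF // -expRD -[leRHS]lnK ?posrE // ler_expR.
have n0' : 0 < n%:R :> R by rewrite ltr0n.
have : ln (s * n%:R) < s * n%:R by apply: ln_sublinear; rewrite mulr_gt0.
rewrite lnM ?posrE // => /ltW h2.
have := ler_wpM2l (ltW c0) h2.
have -> : c * (s * n%:R) = b / 2 * n%:R by rewrite /s; field; rewrite gt_eqF.
move: h; rewrite ler_pdivrMr ?divr_gt0 //; lra.
Unshelve. all: end_near. Qed.

Lemma Jrho_ge (r K : R) : 0 < r < 1 / 2 -> r <= expR (- (2 * K)) / 4 -> K <= Jrho r.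
Proof.
move=> r01 rK; have : expR (- (2 * Jrho r)) <= expR (- (2 * K)); last first.
  by rewrite ler_expR; lra.
rewrite Jrho_sq; last lra.
by nra.
Qed.

(** Checks the two conditions on cluster sizes, for [n0 = N / (2 * beta)] and [m = N * e0]; [e0] is
    chosen so that [e0 * A = eta / 16]. *)
Lemma cluster_size_bounds (N eta A e0 beta : R) :
  0 < eta <= 1 / 4 -> 4 / eta + 20 <= N -> 1 <= A -> e0 = eta / (16 * A) ->
  1 / 2 <= beta <= 1 + eta / 4 ->
  4 * (N * e0) + 4 < N / (2 * beta) /\
  (1 - eta) * (N / 2) + 2 * (N * e0) * A <= N / (2 * beta) - 1.
Proof.
move=> eta01 nbig A1 e0E beta01.
have h4 : 0 <= 4 / eta by rewrite divr_ge0; lra.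
have e0A : e0 * A = eta / 16 by rewrite e0E; field; lra.
have e0_gt0 : 0 <= e0 by rewrite e0E divr_ge0; lra.
have e0_le : e0 <= eta / 16 by rewrite -e0A ler_peMr.
have N0 : 0 <= N by lra.
have neta : 4 <= N * eta by rewrite -ler_pdivrMr; lra.
have lower : N / 2 * (1 - eta / 4) <= N / (2 * beta).
  rewrite ler_pdivlMr; last lra.
  have -> : N / 2 * (1 - eta / 4) * (2 * beta) = N * ((1 - eta / 4) * beta) by field.
  by rewrite ler_piMr //; nra.
split; first by apply: lt_le_trans lower; nra.
have -> : 2 * (N * e0) * A = N * eta / 8.
  by rewrite -[2 * (N * e0) * A]mulrA -[N * e0 * A]mulrA e0A; field.
lra.
Qed.

Lemma info_ratio_bounds (eta M a b : R) : 0 < eta <= 1 / 4 -> 0 < M -> 0 <= a -> 0 <= b ->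
  (a + b) / M <= eta ^+ 2 / 2 -> a <= eta ^+ 2 * M /\ 2 * b <= eta * M.
Proof.
move=> eta01 M0 a0 b0; rewrite ler_pdivrMr // => H.
have : eta ^+ 2 * M <= eta * M by rewrite ler_pM2r // expr2 ler_piMl; lra.
have : 0 <= eta ^+ 2 * M by rewrite mulr_ge0 ?sqr_ge0 ?ltW.
by move=> *; split; lra.
Qed.

Lemma ln3_le_Jrho (eta c r : R) : 0 < eta -> c < 1 -> 0 < r < 1 / 2 ->
  r <= expR (- (2 * (ln 3 / (eta * (1 - c))))) / 4 -> ln 3 <= eta * ((1 - c) * Jrho r).
Proof.
move=> eta0 c1 r01 /(Jrho_ge r01); rewrite ler_pdivrMr; first lra.
by apply: mulr_gt0; lra.
Qed.

Lemma expRN_le (eta M k : R) : 0 < eta -> 0 < k -> - ln k / eta <= M -> expR (- (eta * M)) <= k.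
Proof.
move=> eta0 k0 h; rewrite -[leRHS]lnK ?posrE // ler_expR lerNl mulrC.
by rewrite -ler_pdivrMr.
Qed.

End Asymptotics.

(** * Monotonicity of the model probability and the final limit *)

Lemma imlsbm_prob_le (R : realType) n L (rho : R) (p q : 'I_L -> R) (zs : 'I_n -> bool)
    (E F : imlsbm_outcome L n -> bool) :
  0 < rho < 1 / 2 -> (forall l, 0 < q l < p l /\ p l < 1) ->
  (forall w, E w -> F w) ->
  imlsbm_prob rho p q zs E <= imlsbm_prob rho p q zs F.
Proof.
move=> rho01 pq01 EF; rewrite !imlsbm_probE; apply: imlsbm_mean_le => // w.
by have := EF w; case: (E w) => // ->.
Qed.

Lemma imlsbm_prob01 (R : realType) n L (rho : R) (p q : 'I_L -> R) (zs : 'I_n -> bool)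
    (E : imlsbm_outcome L n -> bool) :
  0 < rho < 1 / 2 -> (forall l, 0 < q l < p l /\ p l < 1) ->
  0 <= imlsbm_prob rho p q zs E <= 1.
Proof.
move=> rho01 pq01; rewrite imlsbm_probE.
rewrite -[X in X <= _](imlsbm_mean_cst rho p q zs) -[X in _ && (_ <= X)](imlsbm_mean_cst rho p q zs).
apply/andP; split; apply: imlsbm_mean_le => // w; case: (E w) => /=;
by rewrite ?ler01.
Qed.

Theorem mainTheorem17 (R : realType) (L : nat -> nat) (rho : nat -> R)
  (p q : forall n, 'I_(L n) -> R) (beta : nat -> R)
  (Init : forall n, ('I_(L n) -> 'I_n.-1 -> 'I_n.-1 -> bool) -> 'I_n.-1 -> bool)
  (est : forall n, ('I_(L n) -> 'I_n -> 'I_n -> bool) -> 'I_n -> bool) :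
                  
  (forall n, (0 < L n)%N) ->
  (forall n, 0 < rho n < 1 / 2) ->
  rho @ \oo --> 0 ->
  (forall n (l : 'I_(L n)), 0 < q n l < p n l /\ p n l < 1) ->
  (exists C : R, forall n (l : 'I_(L n)), p n l <= C * q n l) ->
  (fun n => \big[Num.max/0]_(l < L n) p n l) @ \oo --> 0 ->
  beta @ \oo --> (1 : R) ->
  (exists c : R, 0 < c /\ forall n, (0 < n)%N -> (L n)%:R <= n%:R `^ c) ->
                                 
  (exists delta : nat -> R, delta @ \oo --> 0 /\
    exists eps : R, 0 < eps /\ exists C' : R, 0 < C' /\
    forall n (zs : {ffun 'I_n -> bool}), in_Pn (beta n) zs ->
    forall i : 'I_n,
      imlsbm_prob (rho n) (p n) (q n) zs
        (fun w => n%:R * delta n < (init_err (ztilde Init (adj_of w) i) zs i)%:R)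
      <= C' * n%:R `^ (- (1 + eps))) ->
                             
  (exists c' : R, 0 < c' < 1 /\
    (fun n => (ln (L n)%:R + (L n)%:R * expR (- (c' * Jrho (rho n))))
              / minIcal n (rho n) (p n) (q n)) @ \oo --> 0) ->
  (fun n => minIcal n (rho n) (p n) (q n)) @ \oo --> +oo ->
                                                                       
  (forall n (A : 'I_(L n) -> 'I_n -> 'I_n -> bool),
      alg3_global_output Init (rho n) (p n) (q n) A (est n A)) ->
  exists dbar : nat -> R, dbar @ \oo --> 0 /\
    (fun n => \big[Num.min/1]_(zs : {ffun 'I_n -> bool} | `[< in_Pn (beta n) zs >])
        imlsbm_prob (rho n) (p n) (q n) zs
          (fun w => loss R (est n (adj_of w)) zs
                    <= expR (- ((1 - dbar n) * minIcal n (rho n) (p n) (q n)))))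
      @ \oo --> (1 : R).
Proof.
move=> L0 rho01 rho0 pq01 [C pC] p0 beta1 [c [c0 Lc]] [delta [delta0 [eps [eps0 [C' [C'0 Hinit]]]]]]
  [c' [c'01 Hinfo]] HM Hest.
pose M n := minIcal n (rho n) (p n) (q n).
pose Q n x := \big[Num.min/1]_(zs : {ffun 'I_n -> bool} | `[< in_Pn (beta n) zs >])
        imlsbm_prob (rho n) (p n) (q n) zs
          (fun w => loss R (est n (adj_of w)) zs <= expR (- ((1 - x) * M n))).
suff [d d0 dQ] : exists2 d : nat -> R, d @ \oo --> 0 & (fun n => Q n (d n)) @ \oo --> (1 : R).
  by exists d.
have nearM K : \forall n \near \oo, K <= M n by move/cvgryPge : HM; apply.
apply: diagonal_cvg1.
- move=> n x; apply/andP; split; last exact: bigmin_le_id.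
  by apply: le_bigmin => // zs _; case/andP: (imlsbm_prob01 zs (fun w =>
    loss R (est n (adj_of w)) zs <= expR (- ((1 - x) * M n))) (rho01 n) (pq01 n)).
- near=> n; move=> x y xy.
  have M0 : 0 <= M n by near: n; exact: nearM.
  apply: le_bigmin2 => zs _; apply: imlsbm_prob_le; [exact: rho01|exact: pq01|] => w /le_trans; apply.
  by rewrite ler_expR lerN2 ler_wpM2r // lerD2l lerN2.
have thirds (x y z k : R) : x <= k / 3 -> y <= k / 3 -> z <= k / 3 -> 1 - k <= 1 - x - y - z.
  by lra.
(* The bound for fixed n loses [5 * eta] in the exponent. *)
move=> eta5 eta501; pose eta := eta5 / 5.
have eta01 : 0 < eta <= 1 / 4 by rewrite /eta; lra.
have [eta_gt0 eta_le] := andP eta01.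
have C1 : 1 <= C.
  have [/andP[q0 qp] p1] := pq01 0%N (Ordinal (L0 0%N)).
  have := pC 0%N (Ordinal (L0 0%N)); nra.
(* [tau] is the margin kept from 0 and 1 by the Chernoff parameter, and [e0] below is the tolerated
   fraction of wrong initial labels and of flips per layer. *)
pose tau := eta / 2; pose A := 1 + 4 * C / tau.
have tau0 : 0 < tau by rewrite divr_gt0.
have A1 : 1 <= A by rewrite /A lerDl divr_ge0 ?(ltW tau0) //; lra.
pose e0 := eta / (16 * A).
have A0 : 0 < A := lt_le_trans ltr01 A1.
have e0_gt0 : 0 < e0 by rewrite divr_gt0 // mulr_gt0.
have k0 : 0 < eta5 / 3 by lra.
have half_e0 : 0 < e0 / 2 by rewrite divr_gt0.
near=> n.
have n_gt0 : (0 < n)%N by near: n; exact: nbhs_infty_gt.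
have nbig : 4 / eta + 20 <= n%:R by near: n; exact: nbhs_infty_ger.
have M1 : 2 / eta <= M n by near: n; exact: nearM.
have M2 : - ln (eta5 / 3) / eta <= M n by near: n; exact: nearM.
have Ieta : (ln (L n)%:R + (L n)%:R * expR (- (c' * Jrho (rho n)))) / M n <= eta ^+ 2 / 2.
  by near: n; apply: cvgr_le Hinfo _ _; rewrite divr_gt0 // exprn_gt0.
have rho_e : rho n <= e0 / 2 / expR 1.
  by near: n; apply: cvgr_le rho0 _ _; rewrite divr_gt0 ?expR_gt0.
have rho_J : rho n <= expR (- (2 * (ln 3 / (eta * (1 - c'))))) / 4.
  by near: n; apply: cvgr_le rho0 _ _; rewrite divr_gt0 ?expR_gt0.
have pmax : \big[Num.max/0]_(l < L n) p n l <= 1 / 2.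
  by near: n; apply: cvgr_le p0 _ _; rewrite divr_gt0.
have dle : delta n <= e0 by near: n; apply: cvgr_le delta0 _ _.
have b01 : 1 / 2 <= beta n <= 1 + eta / 4.
  apply/andP; split; near: n; [apply: cvgr_ge beta1 _ _|apply: cvgr_le beta1 _ _].
    by rewrite ltr_pdivrMr // mul1r ltrDl.
  by rewrite ltrDl divr_gt0.
have k1 : n%:R * (C' * n%:R `^ (- (1 + eps))) <= eta5 / 3.
  by near: n; exact: near_powRN_small.
have k2 : n%:R `^ c * expR (- (n%:R * (e0 / 2))) <= eta5 / 3.
  by near: n; exact: near_powR_expRN_small.
have M0 : 0 < M n by apply: lt_le_trans M1; rewrite divr_gt0.
have n0 : 0 < n%:R :> R by rewrite ltr0n.
apply: le_bigmin => [|zs /asboolP zsP].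
  by rewrite gerBl; case/andP: eta501 => /ltW.
pose m := n%:R * e0.
have [mn0 mA] := cluster_size_bounds eta01 nbig A1 erefl b01; rewrite -/m in mn0 mA.
have n0_le b := in_Pn_card b zsP.
have p2 l : p n l <= 1 / 2 by apply: le_trans pmax; exact: le_bigmax.
have lnL0 : 0 <= ln (L n)%:R :> R by rewrite ln_ge0 // ler1n.
have [lnL Lexp] := info_ratio_bounds eta01 M0 lnL0 (mulr_ge0 (ler0n _ _) (expR_ge0 _)) Ieta.
have c'1 : c' < 1 by case/andP: c'01.
have J3 := ln3_le_Jrho eta_gt0 c'1 (rho01 n) rho_J.
have Meta : 2 <= eta * M n by rewrite mulrC -ler_pdivrMr.
have bad i : imlsbm_mean (rho n) (p n) (q n) zs (fun w =>
    (node_bad (rho n) (p n) (q n) zs i (fun A => ztilde Init A i) m w)%:R)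
    <= expR (- ((1 - 4 * eta) * M n)).
  apply: (@node_bad_prob R n (L n) (rho n) (p n) (q n) zs i _ tau C eta
    (n%:R / (2 * beta n)) m _ _ _ _ _ _ _ _ c') => //.
  by move=> B B'; exact: ztilde_local.
have init i : imlsbm_prob (rho n) (p n) (q n) zs
    (fun w => m < (init_err (ztilde Init (adj_of w) i) zs i)%:R) <= C' * n%:R `^ (- (1 + eps)).
  apply: le_trans (Hinit n zs zsP i); apply: imlsbm_prob_le => // w.
  by apply: le_lt_trans; rewrite ler_pM2l.
have rho_e' : rho n * expR 1 <= e0 / 2 by rewrite -ler_pdivlMr ?expR_gt0.
have flips l := @flips_tail R L n (rho n) (p n) (q n) zs m (rho01 n) l e0 erefl rho_e'.
have := @loss_prob_ge R L Init n (rho n) (p n) (q n) zs (n%:R / (2 * beta n)) m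
  (rho01 n) (pq01 n) n_gt0 n0_le mn0 (est n) eta (M n) _ _ (Hest n) bad init flips.
have -> : 5 * eta = eta5 by rewrite mulrC divfK.
apply: le_trans.
(* The three error terms, from initialization, flips and Markov's inequality, each get a third of
   [eta5]. *)
have k3 : (L n)%:R * expR (- (n%:R * (e0 / 2))) <= eta5 / 3.
  by apply: le_trans k2; rewrite ler_wpM2r ?expR_ge0 // Lc.
have k4 := expRN_le eta_gt0 k0 M2.
exact: thirds k1 k3 k4.
Unshelve. all: end_near. Qed.
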